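(* Consider the recommendation bandit problem with one target task described in the context. An agent with full knowledge of the source and target matrices $A$ and $B$ (in addition to the vectors $A\theta^u$, $u\in[U]$) may attain regret \[R_H\le O\left((1-\kappa)\,b\,\sqrt{UH}\,\log\left(\frac{H}{U}\right)\right).\]
   Context: There are $U$ users; each user $u\in[U]$ has a vector $\theta^u\in\mathbb{R}^n$ with $\|\theta^u\|_2\le 1$. There is a source matrix $A\in\mathbb{R}^{a\times n}$ and a single target matrix $B\in\mathbb{R}^{b\times n}$, both of full row rank. The agent is given $A\theta^u$ for every user $u$, but not $\theta^u$. The horizon is $H$. At each round $h\in[H]$ the agent observes a user $u_h\in[U]$ and a finite decision set $\mathcal{A}_h\subset\mathbb{R}^b$, chooses $x\in\mathcal{A}_h$, and observes $X_h=\langle x,B\theta^{u_h}\rangle+\eta_h$ with $\eta_h$ i.i.d. mean-zero $1$-subgaussian. Assume $\max_h\max_{x\in\mathcal{A}_h}\|x\|_2\le 1$ and $\|B\theta^u\|_2\le 1$ for all $u$. The regret is $R_H=\mathbb{E}\big[\sum_{h=1}^H\max_{x\in\mathcal{A}_h}\langle x,B\theta^{u_h}\rangle-\sum_{h=1}^H X_h\big]$. The common information is $\kappa:=\dim(\mathrm{Row}(A)\cap\mathrm{Row}(B))/b$.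
   Formalization: The bound is proved with one absolute constant for horizons H ≥ 2U; this is added because log(H/U) vanishes at H = U (and is negative below), where the claimed regret bound fails. *)

(* Defs.v *)
From HB Require Import structures.
From mathcomp Require Import all_boot all_order all_algebra.
From mathcomp Require Import all_classical all_reals all_analysis.
Set Implicit Arguments. Unset Strict Implicit. Unset Printing Implicit Defensive.
Import Order.TTheory GRing.Theory Num.Theory.
Local Open Scope classical_set_scope.
Local Open Scope ring_scope.

Section Bandit.
Variable R : realType.

Definition norm2 k (v : 'cV[R]_k) : R := Num.sqrt (\sum_(i < k) v i 0 ^+ 2).
Definition dotc k (x y : 'cV[R]_k) : R := \sum_(i < k) x i 0 * y i 0.

Definition kappa a b n (A : 'M[R]_(a, n)) (B : 'M[R]_(b, n)) : R :=
  (\rank (A :&: B)%MS)%:R / b%:R.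

Definition maxover k (s : seq 'cV[R]_k) (f : 'cV[R]_k -> R) : R :=
  foldr (fun x m => Num.max (f x) m) (f (head 0 s)) s.

(* A (deterministic) policy: at round h, given the user sequence, the
   decision-set sequence and the observed-reward sequence, choose an action. *)
Definition policy b U :=
  nat -> (nat -> 'I_U) -> (nat -> seq 'cV[R]_b) -> (nat -> R) -> 'cV[R]_b.

Definition causal b U (pol : policy b U) : Prop :=
  forall h us us' Ds Ds' f f',
    (forall i, (i <= h)%N -> us i = us' i) ->
    (forall i, (i <= h)%N -> Ds i = Ds' i) ->
    (forall i, (i < h)%N -> f i = f' i) ->
    pol h us Ds f = pol h us' Ds' f'.

Section Interaction.
Variables (n b U : nat) (B : 'M[R]_(b, n)) (th : 'I_U -> 'cV[R]_n).
Variables (pol : policy b U) (us : nat -> 'I_U) (Ds : nat -> seq 'cV[R]_b).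
Variables (Omega : Type) (eta : nat -> Omega -> R).

Definition obs (h : nat) (f : nat -> R) (w : Omega) : R :=
  dotc (pol h us Ds f) (B *m th (us h)) + eta h w.

Fixpoint hist (h : nat) (w : Omega) : nat -> R :=
  match h with
  | 0 => fun _ => 0
  | h'.+1 => let f := hist h' w in
             fun i => if i == h' then obs h' f w else f i
  end.

Definition action (h : nat) (w : Omega) : 'cV[R]_b := pol h us Ds (hist h w).
Definition X (h : nat) (w : Omega) : R := obs h (hist h w) w.

Definition realized_regret (H : nat) (w : Omega) : R :=
  \sum_(h < H) (maxover (Ds h) (fun x => dotc x (B *m th (us h))) - X h w).
End Interaction.

Definition iid_subgaussian_noise d (Omega : measurableType d)
    (P : probability Omega R) (H : nat) (eta : nat -> Omega -> R) : Prop :=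
  [/\ forall i, (i < H)%N -> measurable_fun setT (eta i),
      forall (S : seq nat) (Bs : nat -> set R),
        uniq S -> (forall i, i \in S -> (i < H)%N) ->
        (forall i, measurable (Bs i)) ->
        P (\big[setI/setT]_(i <- S) (eta i @^-1` Bs i)) =
        (\prod_(i <- S) P (eta i @^-1` Bs i))%E,
      forall i j (C : set R), (i < H)%N -> (j < H)%N -> measurable C ->
        P (eta i @^-1` C) = P (eta j @^-1` C),
      forall i, (i < H)%N -> ('E_P[eta i] = 0)%E &
      forall i (lam : R), (i < H)%N ->
        (\int[P]_w (expR (lam * eta i w))%:E <= (expR (lam ^+ 2 / 2))%:E)%E].

End Bandit.

(* Main.v *)
Require Import Defs.
From HB Require Import structures.
From mathcomp Require Import all_boot all_order all_algebra.
From mathcomp Require Import all_classical all_reals all_analysis.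
From mathcomp Require Import measurable_realfun perm ring lra zify.
Set Implicit Arguments.
Unset Strict Implicit.
Unset Printing Implicit Defensive.
Import Order.TTheory GRing.Theory Num.Theory.
Local Open Scope classical_set_scope.
Local Open Scope ring_scope.

(** Write [d = b - \rank (A :&: B)]. The source information determines [B *m th u]
    up to the [d]-dimensional space [B (ker A)], so that
    [B *m th u = m u + Q^T *m w u] with [m u] known, [Q] having [d] orthonormal rows
    and [w u] in the unit ball.

    The policy maximises, over actions [x] and points [v] of a finite grid in
    [[-1, 1]^d], the penalised optimistic score [<x, m u + Q^T v> - gamma * loss v],
    where [loss] is the squared loss of [v] on the past rounds of the same user and
    [gamma] is the inverse square root of their number. Comparing with the grid point
    [w'] next to [w u], and writing [z = v - w'] and [q i] for the past vectors [Q x],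
    the regret of a round is at most, up to terms of order [gamma],
    [<q, z> - gamma / 4 * \sum_i <q i, z>^2 + 4 gamma * Y v], where
    [Y v = \sum_i (<q i, z> / 2 * eta i - <q i, z>^2 / 8)]. Young's inequality for the
    Gram matrix [V] turns the first two terms into [gamma * d + <q, V^-1 q> / gamma],
    and the sum of [<q, V^-1 q>] over rounds is at most [2 ln (det V)]. Moreover
    [Y v <= ln N - 1 + (\sum_v' expR (Y v')) / N] for a grid of [N] points, and
    [expR (Y v')] has expectation at most 1, since it is a product of conditionally
    subgaussian factors. No high-probability argument is therefore needed, and the
    bounds of the users, of order [d sqrt T_u ln (d T_u)], are added up by AM-GM. This
    uses [d ^ 2 <= H / U]; otherwise the trivial bound [2 H] suffices. *)

(** * Independence and Fubini *)

Section Independence.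
Context (R : realType) (d d' d2 : measure_display) (T : measurableType d) (T' : measurableType d').
Context (T2 : measurableType d2).
Variables (P : probability T R) (phi : T -> T') (xi : T -> T2).
Hypotheses (mphi : measurable_fun setT phi) (mxi : measurable_fun setT xi).
Variable G : set (set T').
Hypotheses (mG : measurable = <<s G >>) (GI : setI_closed G) (GT : G setT).
Hypothesis indepG : forall A C, G A -> measurable C ->
  P (phi @^-1` A `&` xi @^-1` C) = (P (phi @^-1` A) * P (xi @^-1` C))%E.

Let Phi : {RV P >-> T'} := mfun_Sub (mem_set mphi).
Let Xi : {RV P >-> T2} := mfun_Sub (mem_set mxi).

Let mxiI A : measurable A -> measurable (xi @^-1` A).
Proof. by move=> mA; rewrite -[X in measurable X]setTI; exact: mxi. Qed.

(** For fixed [C] both sides are finite measures in [A], the right one being a scaled law of [phi].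
    They agree on the pi-system [G], hence on the sigma-algebra it generates. *)
Lemma indep_sigma_algebra A C : measurable A -> measurable C ->
  P (phi @^-1` A `&` xi @^-1` C) = (P (phi @^-1` A) * P (xi @^-1` C))%E.
Proof.
move=> mA mC.
have cfin : P (xi @^-1` C) \is a fin_num by apply: fin_num_measure; exact: mxiI.
have c0 : 0 <= fine (P (xi @^-1` C)) by exact: fine_ge0.
pose c := NngNum c0.
pose m1 := pushforward (mrestr P (mxiI mC)) phi.
pose m2 := mscale c (distribution P Phi).
rewrite muleC -(fineK cfin).
apply: (@measure_unique _ _ _ G (fun=> setT) mG GI _ _ m1 m2) => //.
- by rewrite bigcup_const.
- move=> B GB; rewrite -[LHS]/(P (phi @^-1` B `&` xi @^-1` C)) indepG // muleC.
  by rewrite -{1}(fineK cfin).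
- move=> _; rewrite -[X in (X < _)%E]/(P (setT `&` xi @^-1` C)) setTI.
  by rewrite ltey_eq cfin.
Qed.
(** By independence the joint law of [phi] and [xi] is the product of their laws; Tonelli then
    integrates [xi] out first, with [phi] frozen. *)
Lemma indep_integral (f : T' * T2 -> \bar R) :
  measurable_fun setT f -> (forall z, (0 <= f z)%E) ->
  (\int[P]_w f (phi w, xi w) = \int[P]_w \int[P]_v f (phi w, xi v))%E.
Proof.
move=> mf f0.
have mpair : measurable_fun setT (fun w => (phi w, xi w)).
  exact: measurable_fun_pair.
pose Z : {RV P >-> (T' * T2)%type} := mfun_Sub (mem_set mpair).
transitivity (\int[distribution P Z]_z f z)%E.
  by rewrite ge0_integral_distribution.
transitivity (\int[distribution P Phi \x distribution P Xi]_z f z)%E.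
  apply: eq_measure_integral => A mA _; apply/esym.
  apply: product_measure_unique => // B C mB mC.
  by rewrite /= /pushforward -indep_sigma_algebra.
rewrite fubini_tonelli1 //.
rewrite ge0_integral_distribution //; first last.
- by move=> y; exact: integral_ge0.
- exact: measurable_fun_fubini_tonelli_F.
apply: eq_integral => w _; rewrite /fubini_F /=.
rewrite ge0_integral_distribution //.
by apply: measurableT_comp => //; exact: measurable_pair1.
Qed.

Lemma indep_integral_measurable (f : T' * T2 -> \bar R) :
  measurable_fun setT f -> (forall z, (0 <= f z)%E) ->
  measurable_fun setT (fun w => \int[P]_v f (phi w, xi v))%E.
Proof.
move=> mf f0.
have -> : (fun w => \int[P]_v f (phi w, xi v))%E =
    (fun x => \int[distribution P Xi]_y f (x, y))%E \o phi.
  apply/funext => w /=; rewrite ge0_integral_distribution //.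
  by apply: measurableT_comp => //; exact: measurable_pair1.
by apply: measurableT_comp => //; exact: measurable_fun_fubini_tonelli_F.
Qed.
End Independence.

(** * Exponential supermartingale of the noise *)

Section Past.
Context (R : realType) (d : measure_display) (T : measurableType d).
Variable eta : nat -> T -> R.

(** Cylinder events form a pi-system on which the independence hypothesis can be read off. The
    sigma-algebra they generate is put on [T] as a second measurable type, so that predictability
    becomes plain measurability. *)
Definition past (h : nat) : set (set T) :=
  [set A | exists2 Bs : nat -> set R, forall i, measurable (Bs i) &
     A = \big[setI/setT]_(i <- iota 0 h) (eta i @^-1` Bs i)].

Notation pastType h := (g_sigma_algebraType (past h)).

Lemma past_setI_closed h : setI_closed (past h).
Proof.
move=> _ _ [Bs mBs ->] [Cs mCs ->].
exists (fun i => Bs i `&` Cs i); first by move=> i; exact: measurableI.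
by rewrite -big_split.
Qed.

Lemma past_setT h : past h setT.
Proof.
exists (fun=> setT) => //.
by rewrite big1.
Qed.

Lemma past_preimage h i C : (i < h)%N -> measurable C -> past h (eta i @^-1` C).
Proof.
move=> ih mC; exists (fun j => if j == i then C else setT).
  by move=> j; case: ifP.
rewrite (bigD1_seq i) /= ?mem_iota ?iota_uniq // eqxx big1 ?setIT // => j /negPf ->.
by rewrite preimage_setT.
Qed.

Lemma measurable_past h i : (i < h)%N ->
  measurable_fun (T := pastType h) setT (eta i).
Proof.
move=> ih _ C mC; rewrite setTI; apply: sub_sigma_algebra.
exact: past_preimage.
Qed.

(** Preimages of the generating cylinders suffice. With [phi := id] this compares the sigma-algebras
    of the past with one another and with the ambient one. *)
Lemma measurable_past_minimal (d' : measure_display) (T' : measurableType d') h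
    (phi : T' -> T) : (forall i, (i < h)%N -> measurable_fun setT (eta i \o phi)) ->
  measurable_fun (U := pastType h) setT phi.
Proof.
move=> meta; apply: (@measurability _ _ T' (pastType h) setT phi (past h)) => //.
move=> _ [_ [Bs mBs ->] <-]; rewrite setTI.
have -> : phi @^-1` (\big[setI/setT]_(i <- iota 0 h) (eta i @^-1` Bs i)) =
    \big[setI/setT]_(i <- iota 0 h) ((eta i \o phi) @^-1` Bs i).
  by apply: (big_morph (fun A : set T => phi @^-1` A)).
rewrite big_seq; apply: bigsetI_measurable => i.
rewrite mem_iota add0n /= => ih.
by rewrite -[X in measurable X]setTI; exact: meta.
Qed.

Lemma measurable_fun_past (d' : measure_display) (T' : measurableType d') h i
    (f : T -> T') : (i <= h)%N ->
  measurable_fun (T := pastType i) setT f -> measurable_fun (T := pastType h) setT f.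
Proof.
move=> ih mf.
have mid : measurable_fun (T := pastType h) (U := pastType i) setT id.
  apply: (@measurable_past_minimal _ (pastType h)) => j ji.
  exact: (measurable_past (leq_trans ji ih)).
exact: (measurableT_comp mf mid).
Qed.
End Past.

Notation pastType eta h := (g_sigma_algebraType (past eta h)).

Section Supermartingale.
Context (R : realType) (d : measure_display) (T : measurableType d).
Variables (P : probability T R) (H : nat) (eta : nat -> T -> R).
Hypothesis noise : iid_subgaussian_noise P H eta.

Lemma past_indep h A C : (h < H)%N -> past eta h A -> measurable C ->
  P (A `&` eta h @^-1` C) = (P A * P (eta h @^-1` C))%E.
Proof.
case: noise => meta indep _ _ _ hH [Bs mBs ->] mC.
rewrite setIC muleC.
(* Putting [C] at index [h] makes one family of sets, to which independence is applied over
   [h :: iota 0 h] and over [iota 0 h]. *)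
have mBs' i : measurable (if i == h then C else Bs i) by case: ifP.
have eqB : \big[setI/setT]_(i <- iota 0 h) (eta i @^-1` Bs i) =
    \big[setI/setT]_(i <- iota 0 h) (eta i @^-1` (if i == h then C else Bs i)).
  apply: eq_big_seq => i; rewrite mem_iota add0n /= => ih.
  by rewrite ltn_eqF.
have sub (i : nat) : i \in iota 0 h -> (i < H)%N.
  by rewrite mem_iota add0n /= => ih; exact: ltn_trans hH.
have := indep (h :: iota 0 h) (fun i => if i == h then C else Bs i).
rewrite !big_cons eqxx -eqB => -> //; last first.
- by move=> i; rewrite inE => /predU1P[->//|/sub].
- by rewrite /= iota_uniq mem_iota add0n ltnn andbF.
rewrite eqB (indep (iota 0 h)) // ?iota_uniq //.
Qed.

(** The last noise variable is integrated out: given the past, [lam h] is a constant, and the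
    subgaussian bound makes the last factor integrate to at most 1. *)
Lemma expectation_exp_supermartingale (lam : nat -> T -> R) h : (h <= H)%N ->
  (forall i, (i < h)%N -> measurable_fun (T := pastType eta i) setT (lam i)) ->
  (\int[P]_w (expR (\sum_(i < h) (lam i w * eta i w - lam i w ^+ 2 / 2)))%:E <= 1)%E.
Proof.
case: (noise) => meta _ _ _ mgf.
elim: h => [|h IH] hH mlam.
  under eq_integral do rewrite big_ord0 expR0.
  by rewrite integral_cst // mul1e; exact: probability_le1.
pose M w := expR (\sum_(i < h) (lam i w * eta i w - lam i w ^+ 2 / 2)).
have mlamh i : (i <= h)%N -> measurable_fun (T := pastType eta h) setT (lam i).
  by move=> ih; exact: (measurable_fun_past ih (mlam i ih)).
have mM : measurable_fun (T := pastType eta h) setT M.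
  apply: measurableT_comp => //; apply: measurable_sum => i.
  apply: measurable_funB.
    by apply: measurable_funM; [exact: mlamh (ltnW _)|exact: measurable_past].
  apply: measurable_funM => //; apply: measurable_funX.
  exact: mlamh (ltnW _).
pose f (z : pastType eta h * R) : \bar R :=
  (M z.1 * expR (lam h z.1 * z.2 - lam h z.1 ^+ 2 / 2))%:E.
have mf : measurable_fun setT f.
  apply/measurable_EFinP; apply: measurable_funM.
    exact: measurableT_comp.
  apply: measurableT_comp => //; apply: measurable_funB.
    by apply: measurable_funM => //; apply: measurableT_comp => //; exact: mlamh.
  apply: measurable_funM => //; apply: measurable_funX.
  by apply: measurableT_comp => //; exact: mlamh.
have f0 z : (0 <= f z)%E by rewrite lee_fin mulr_ge0 // expR_ge0.
have mid : measurable_fun (U := pastType eta h) setT (id : T -> T).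
  by apply: measurable_past_minimal => i ih; apply: meta; exact: ltn_trans hH.
under eq_integral do rewrite big_ord_recr /= expRD.
rewrite (@indep_integral R d _ _ T (pastType eta h) R P id (eta h) mid (meta _ hH)
  (past eta h) _ (@past_setI_closed _ _ _ _ _) (past_setT _ _) _ f) //; last first.
  by move=> A C pA mC; exact: past_indep.
apply: le_trans (IH (ltnW hH) (fun i ih => mlam i (ltnW ih))).
have mM' : measurable_fun setT M.
  exact: (measurableT_comp mM mid).
apply: ge0_le_integral => //.
- by move=> w _; exact: integral_ge0.
- exact: (@indep_integral_measurable R d _ _ T (pastType eta h) R P id (eta h) mid (meta _ hH) f mf f0).
- exact/measurable_EFinP.
move=> w _; rewrite /f /=.
have meh : measurable_fun setT (eta h) by exact: meta.
under eq_integral do rewrite EFinM.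
rewrite ge0_integralZl //; first last.
- by rewrite lee_fin expR_ge0.
- apply/measurable_EFinP; apply: measurableT_comp => //.
  by apply: measurable_funB => //; apply: measurable_funM.
rewrite -[leRHS]mule1 lee_wpmul2l // ?lee_fin ?expR_ge0 //.
under eq_integral do rewrite expRD EFinM muleC.
rewrite ge0_integralZl //; first last.
- by apply/measurable_EFinP; apply: measurableT_comp => //; apply: measurable_funM.
rewrite expRN muleC lee_pdivrMr ?expR_gt0 // mul1e.
exact: mgf.
Qed.
End Supermartingale.

(** * The unidentified subspace *)

Section Orthonormal.
Variable R : realType.

(** Gram-Schmidt by induction: the residue [w'] of the first row, after projection on the rows
    already found, is normalised. *)
Lemma orthonormal_rows d b (W : 'M[R]_(d, b)) : row_free W ->
  exists2 Q : 'M[R]_(d, b), Q *m Q^T = 1%:M & (W <= Q)%MS.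
Proof.
elim: d W => [|d IH].
  by move=> W _; exists W; [apply/matrixP => -[] | ].
rewrite -[d.+1]/(1 + d)%N => W.
rewrite -[W]vsubmxK; set w := usubmx _; set W' := dsubmx _.
move=> Wfree.
have W'free : row_free W'.
  rewrite /row_free eqn_leq rank_leq_row /=.
  have := (mxrank_adds_leqif w W').1; rewrite addsmxE (eqP (Wfree : \rank _ == _)).
  have := rank_leq_row w; lia.
have [Q' QQ WQ] := IH _ W'free.
pose w' := w - w *m Q'^T *m Q'.
have w'Q : w' *m Q'^T = 0.
  by rewrite mulmxBl -[X in _ - X]mulmxA QQ mulmx1 subrr.
(* A zero residue would put [d.+1] independent rows in the span of the [d] rows of [Q']. *)
have w'0 : w' != 0.
  apply/eqP => w'0.
  have wQ : (w <= Q')%MS.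
    move/eqP: w'0; rewrite subr_eq0 => /eqP ->; exact: submxMl.
  have : (\rank (col_mx w W') <= \rank Q')%N.
    by apply: mxrankS; rewrite col_mx_sub wQ.
  rewrite (eqP (Wfree : \rank _ == _)) => h.
  by have := leq_trans h (rank_leq_row Q'); rewrite ltnn.
pose c := (w' *m w'^T) 0 0.
have cE : c = \sum_j w' 0 j ^+ 2.
  by rewrite /c mxE; apply: eq_bigr => j _; rewrite [_^T _ _]mxE expr2.
have c0 : 0 < c.
  rewrite lt_neqAle cE sumr_ge0 ?andbT => [|j _]; last exact: sqr_ge0.
  apply: contra w'0 => /eqP/esym/eqP; rewrite psumr_eq0 => [/allP h|j _]; last exact: sqr_ge0.
  apply/eqP/rowP => j; have := h j (mem_index_enum j); rewrite [RHS]mxE /= sqrf_eq0 => /eqP; exact.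
pose q := (Num.sqrt c)^-1 *: w'.
have sc0 : Num.sqrt c != 0 by rewrite gt_eqF // sqrtr_gt0.
exists (col_mx q Q').
  rewrite tr_col_mx mul_col_row QQ (scalar_mx_block 1 d 1).
  congr block_mx.
  - apply/matrixP => i j; rewrite !ord1 /q linearZ /= -scalemxAl -scalemxAr scalerA.
    rewrite mxE -/c mxE eqxx /= -{3}(sqr_sqrtr (ltW c0)) expr2 mulrACA mulVf //.
    by rewrite mulr1.
  - by rewrite /q -scalemxAl w'Q scaler0.
  - apply: trmx_inj; rewrite trmx_mul trmxK /q -scalemxAl w'Q.
    by rewrite scaler0 trmx0.
rewrite col_mx_sub; apply/andP; split; last first.
  apply: submx_trans WQ _; have := submx_refl (col_mx q Q').
  by rewrite {1}col_mx_sub => /andP[].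
have := submx_refl (col_mx q Q'); rewrite {1}col_mx_sub => /andP[qs Qs].
have -> : w = Num.sqrt c *: q + w *m Q'^T *m Q'.
  by rewrite /q scalerA divff // scale1r /w' subrK.
apply: addmx_sub; first exact: scalemx_sub.
exact: submx_trans (submxMl _ _) Qs.
Qed.

(** Rank-nullity for [B] on the kernel of [A], spanned by the rows of [kermx A^T]: it has dimension
    [n - a] and meets the kernel of [B] in dimension [n - \rank (A + B)], where
    [\rank (A + B) = a + b - \rank (A :&: B)]. *)
Lemma rank_image_ker a b n (A : 'M[R]_(a, n)) (B : 'M[R]_(b, n)) :
  row_free A -> row_free B ->
  (\rank (kermx A^T *m B^T) + \rank (A :&: B)%MS)%N = b.
Proof.
move=> /eqP rA /eqP rB.
have := mxrank_mul_ker (kermx A^T) B^T.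
have -> : \rank (kermx A^T :&: kermx B^T)%MS = (n - \rank (A + B)%MS)%N.
  have -> : \rank (A + B)%MS = \rank (row_mx A^T B^T).
    by rewrite addsmxE -mxrank_tr tr_col_mx.
  rewrite -mxrank_ker; apply/eqmx_rank; apply/andP; split.
    apply/sub_kermxP; rewrite mul_mx_row.
    have /sub_kermxP -> := capmxSl (kermx A^T) (kermx B^T).
    have /sub_kermxP -> := capmxSr (kermx A^T) (kermx B^T).
    exact: row_mx0.
  have /sub_kermxP := submx_refl (kermx (row_mx A^T B^T)).
  rewrite mul_mx_row -row_mx0 => /eq_row_mx[kA kB].
  by rewrite sub_capmx; apply/andP; split; apply/sub_kermxP.
rewrite mxrank_ker mxrank_tr rA.
have := mxrank_sum_cap A B; rewrite rA rB.
have := rank_leq_col (A + B)%MS.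
have := rank_leq_col A; rewrite rA.
lia.
Qed.

(** Vectors with the same image under [A] differ by some [z] in its kernel, so the ambiguity of the
    target parameter is a vector [B *m z]. The rows of [Q] are an orthonormal basis of the space of
    these, and [Q^T *m Q] projects onto it. *)
Lemma unknown_part_basis a b n (A : 'M[R]_(a, n)) (B : 'M[R]_(b, n)) :
  row_free A -> row_free B ->
  exists2 Q : 'M[R]_(b - \rank (A :&: B)%MS, b), Q *m Q^T = 1%:M &
    forall z : 'cV[R]_n, A *m z = 0 -> Q^T *m Q *m (B *m z) = B *m z.
Proof.
move=> rA rB; have := rank_image_ker rA rB.
set W := kermx A^T *m B^T => rW.
have -> : (b - \rank (A :&: B)%MS)%N = \rank W by lia.
have [Q QQ WQ] := orthonormal_rows (row_base_free W).
exists Q => // z Az0.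
have zW : ((B *m z)^T <= Q)%MS.
  apply: submx_trans WQ; rewrite eq_row_base trmx_mul submxMr //.
  by apply/sub_kermxP; rewrite -trmx_mul Az0 trmx0.
have /submxP[D DE] := zW.
apply: trmx_inj; rewrite trmx_mul [(Q^T *m Q)^T]trmx_mul trmxK DE.
by rewrite -[D *m Q *m _]mulmxA (mulmxA Q) QQ mul1mx.
Qed.
End Orthonormal.

(** * Gram matrices and leverage scores *)

Lemma big_ord_recr_cond (V : nmodType) (S : pred nat) (F : nat -> V) h :
  \sum_(i < h.+1 | S i) F i = \sum_(i < h | S i) F i + (if S h then F h else 0).
Proof. by rewrite big_mkcond big_ord_recr -big_mkcond. Qed.

Section Dotc.
Variable R : realType.
Implicit Types k : nat.

Lemma dotcE k (x y : 'cV[R]_k) : dotc x y = (x^T *m y) 0 0.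
Proof. by rewrite mxE; apply: eq_bigr => i _; rewrite mxE. Qed.

Lemma dotcC k (x y : 'cV[R]_k) : dotc x y = dotc y x.
Proof. by apply: eq_bigr => i _; rewrite mulrC. Qed.

Lemma dotcDr k (x y z : 'cV[R]_k) : dotc x (y + z) = dotc x y + dotc x z.
Proof. by rewrite !dotcE mulmxDr mxE. Qed.

Lemma dotcBr k (x y z : 'cV[R]_k) : dotc x (y - z) = dotc x y - dotc x z.
Proof. by rewrite !dotcE mulmxBr !mxE. Qed.

Lemma dotcZr k a (x y : 'cV[R]_k) : dotc x (a *: y) = a * dotc x y.
Proof. by rewrite !dotcE -scalemxAr mxE. Qed.

Lemma dotcBl k (x y z : 'cV[R]_k) : dotc (x - y) z = dotc x z - dotc y z.
Proof. by rewrite dotcC dotcBr !(dotcC z). Qed.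

Lemma dotcZl k a (x y : 'cV[R]_k) : dotc (a *: x) y = a * dotc x y.
Proof. by rewrite dotcC dotcZr dotcC. Qed.

Lemma dotc_mulmxr k l (M : 'M[R]_(k, l)) (x : 'cV[R]_k) (y : 'cV[R]_l) :
  dotc x (M *m y) = dotc (M^T *m x) y.
Proof. by rewrite !dotcE trmx_mul trmxK mulmxA. Qed.

Lemma dotc_ge0 k (x : 'cV[R]_k) : 0 <= dotc x x.
Proof. by apply: sumr_ge0 => i _; rewrite -expr2 sqr_ge0. Qed.

Lemma dotc_eq0 k (x : 'cV[R]_k) : dotc x x <= 0 -> x = 0.
Proof.
move=> x0; have /eqP : dotc x x = 0 by apply/eqP; rewrite eq_le x0 dotc_ge0.
rewrite psumr_eq0 => [/allP h|i _]; last by rewrite -expr2 sqr_ge0.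
apply/colP => i; have := h i (mem_index_enum i).
by rewrite [RHS]mxE /= -expr2 sqrf_eq0 => /eqP.
Qed.

Lemma dotc_le_half k (x y : 'cV[R]_k) : dotc x y <= (dotc x x + dotc y y) / 2.
Proof.
have := dotc_ge0 (x - y); rewrite dotcBl !dotcBr (dotcC y x); lra.
Qed.

Lemma CauchySchwarz_dotc k (x y : 'cV[R]_k) : dotc x y ^+ 2 <= dotc x x * dotc y y.
Proof.
have [y0|ypos] := leP (dotc y y) 0.
  have -> := dotc_eq0 y0.
  by rewrite -(scale0r (0 : 'cV[R]_k)) !dotcZr !mul0r mulr0 expr0n.
have := dotc_ge0 (dotc y y *: x - dotc x y *: y).
rewrite dotcBl !dotcBr !dotcZl !dotcZr (dotcC y x) => h.
have {}h : 0 <= dotc y y * (dotc x x * dotc y y - dotc x y ^+ 2) by move: h; lra.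
by move: h; rewrite pmulr_rge0 // subr_ge0.
Qed.

Lemma norm2_le1 k (x : 'cV[R]_k) : (norm2 x <= 1) = (dotc x x <= 1).
Proof.
have -> : dotc x x = \sum_(i < k) x i 0 ^+ 2 by apply: eq_bigr => i _; rewrite expr2.
rewrite /norm2 -{1}[1]sqrtr1 ler_sqrt //.
Qed.

Lemma dotc_coord_le1 k (x : 'cV[R]_k) i : dotc x x <= 1 -> `|x i 0| <= 1.
Proof.
move=> x1; rewrite -(expr_le1 (n := 2)) // real_normK ?num_real //.
apply: le_trans x1; rewrite /dotc (bigD1 i) //= -expr2 lerDl.
by apply: sumr_ge0 => j _; rewrite -expr2 sqr_ge0.
Qed.
End Dotc.

Section RankOneUpdate.
Variables (R : realType) (d : nat) (V : 'M[R]_d).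
Hypotheses (Vsym : V^T = V) (Vge1 : forall z, dotc z z <= dotc z (V *m z)).

Definition leverage (q : 'cV[R]_d) := dotc q (invmx V *m q).

Lemma ge1_unitmx : V \in unitmx.
Proof.
rewrite -row_free_unit -kermx_eq0; apply/rowV0P => v /sub_kermxP vV.
apply: trmx_inj; rewrite trmx0; apply: dotc_eq0.
apply: le_trans (Vge1 _) _.
by rewrite -{1}Vsym -trmx_mul vV trmx0 dotcE mulmx0 mxE.
Qed.
Let Vu := ge1_unitmx.

Lemma leverageE q : leverage q = dotc (invmx V *m q) (V *m (invmx V *m q)).
Proof. by rewrite /leverage mulmxA mulmxV // mul1mx dotcC. Qed.

Lemma leverage_ge0 q : 0 <= leverage q.
Proof. by rewrite leverageE; apply: le_trans (Vge1 _); exact: dotc_ge0. Qed.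

Lemma leverage_le1 q : dotc q q <= 1 -> leverage q <= 1.
Proof.
move=> q1; have := dotc_le_half q (invmx V *m q); rewrite -/(leverage q).
have := Vge1 (invmx V *m q); rewrite -leverageE; lra.
Qed.

(** Young's inequality: expand [0 <= <u, V u>] at [u = (c / 2) z - V^-1 q] and divide by [c]. *)
Lemma dotc_leverage c q z : 0 < c ->
  dotc q z <= c / 4 * dotc z (V *m z) + c^-1 * leverage q.
Proof.
move=> c0; pose y := invmx V *m q.
have Vy : V *m y = q by rewrite /y mulmxA mulmxV // mul1mx.
pose u := (c / 2) *: z - y.
have u0 : 0 <= dotc u (V *m u) by apply: le_trans (Vge1 _); exact: dotc_ge0.
have yVz : dotc y (V *m z) = dotc q z by rewrite dotc_mulmxr Vsym Vy.
have yq : dotc y q = leverage q by rewrite dotcC.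
move: u0; rewrite /u mulmxBr -scalemxAr Vy dotcBl !dotcBr !dotcZl !dotcZr yVz yq.
rewrite (dotcC z q) => u0.
rewrite -subr_ge0 -(pmulr_rge0 _ c0).
have -> : c * (c / 4 * dotc z (V *m z) + c^-1 * leverage q - dotc q z) =
  c ^+ 2 / 4 * dotc z (V *m z) + leverage q - c * dotc q z by field; rewrite gt_eqF.
move: u0; lra.
Qed.

(** Matrix determinant lemma: [V] is factored out, and two triangular factorisations of the block
    matrix with blocks [1], [q^T], [- y], [1] are compared. *)
Lemma det_rank1_update q : \det (V + q *m q^T) = \det V * (1 + leverage q).
Proof.
have -> : V + q *m q^T = V *m (1%:M + (invmx V *m q) *m q^T).
  by rewrite mulmxDr mulmx1 -(mulmxA (invmx V)) (mulmxA V) mulmxV // mul1mx.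
rewrite det_mulmx; congr (_ * _).
set y := invmx V *m q.
have E1 : block_mx 1%:M q^T (- y) 1%:M =
    block_mx 1%:M 0 (- y) 1%:M *m block_mx 1%:M q^T 0 (1%:M + y *m q^T).
  rewrite mulmx_block !mulmx1 !mul1mx !mul0mx !addr0 mulNmx.
  by rewrite addrCA addNr addr0.
have E2 : block_mx 1%:M q^T (- y) 1%:M =
    block_mx (1%:M + q^T *m y) q^T 0 1%:M *m block_mx 1%:M 0 (- y) 1%:M.
  rewrite mulmx_block !mulmx1 !mul1mx !mul0mx !mulmx0 !add0r ?addr0 mulmxN.
  by rewrite addrK.
have := E2; rewrite E1 => /(congr1 determinant).
rewrite !det_mulmx !det_ublock !det_lblock !det1 !mulr1 !mul1r => ->.
by rewrite det_mx11 mxE mxE eqxx /leverage dotcE.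
Qed.
End RankOneUpdate.

(** * Log-determinant potential of the leverage scores *)

Section Potential.
Variables (R : realType) (d : nat) (q : nat -> 'cV[R]_d) (S : pred nat).

Definition gram h : 'M[R]_d := 1%:M + \sum_(i < h | S i) q i *m (q i)^T.
Definition visits h : nat := \sum_(i < h) S i.

Lemma gramS h : gram h.+1 = gram h + (if S h then q h *m (q h)^T else 0).
Proof. by rewrite /gram (big_ord_recr_cond S (fun i => q i *m (q i)^T)) addrA. Qed.

Lemma visitsS h : visits h.+1 = (visits h + S h)%N.
Proof. by rewrite /visits big_ord_recr. Qed.

Lemma gram_sym h : (gram h)^T = gram h.
Proof.
elim: h => [|h IH]; first by rewrite /gram big_ord0 addr0 trmx1.
rewrite gramS linearD /= IH; case: ifP => _; last by rewrite trmx0.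
by rewrite trmx_mul trmxK.
Qed.

Lemma gram_quad h z :
  dotc z (gram h *m z) = dotc z z + \sum_(i < h | S i) dotc (q i) z ^+ 2.
Proof.
elim: h => [|h IH]; first by rewrite /gram !big_ord0 !addr0 mul1mx.
rewrite gramS mulmxDl dotcDr IH (big_ord_recr_cond S (fun i => dotc (q i) z ^+ 2)) -addrA.
congr (_ + (_ + _)).
case: ifP => _; last by rewrite mul0mx dotcE mulmx0 mxE.
rewrite -mulmxA dotc_mulmxr.
rewrite [dotc (q h) z]dotcE [LHS]/dotc big_ord1 expr2; congr (_ * _).
Qed.

Lemma gram_ge1 h z : dotc z z <= dotc z (gram h *m z).
Proof.
by rewrite gram_quad lerDl sumr_ge0 // => i _; exact: sqr_ge0.
Qed.

Hypothesis q1 : forall i, S i -> dotc (q i) (q i) <= 1.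

Lemma gram_entry h i j : `|gram h i j| <= 1 + (visits h)%:R.
Proof.
elim: h => [|h IH].
  by rewrite /gram big_ord0 addr0 /visits big_ord0 addr0 mxE; case: eqP; rewrite ?normr1 ?normr0.
rewrite gramS visitsS natrD addrA mxE.
apply: le_trans (ler_normD _ _) _; apply: lerD => //.
case: ifP => Sh; last by rewrite mxE normr0.
rewrite !mxE big_ord1 normrM mxE -[leRHS]mulr1.
by apply: ler_pM => //; apply: dotc_coord_le1; exact: q1.
Qed.

Lemma det_gram_gt0 h : 0 < \det (gram h).
Proof.
elim: h => [|h IH]; first by rewrite /gram big_ord0 addr0 det1.
rewrite gramS; case: ifP => _; last by rewrite addr0.
rewrite det_rank1_update; [|exact: gram_sym|exact: gram_ge1].
rewrite mulr_gt0 // ltr_pwDl //.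
by apply: leverage_ge0; [exact: gram_sym|exact: gram_ge1].
Qed.

(* Leibniz' formula loses a factor [d!] against Hadamard's inequality; this only adds
   [d ln d] to the logarithm, harmless since [d ^ 2 <= H / U] whenever it is used. *)
Lemma det_gram_le h : \det (gram h) <= (d%:R * (1 + (visits h)%:R)) ^+ d.
Proof.
apply: le_trans (ler_norm _) _.
apply: le_trans (ler_norm_sum _ _ _) _.
apply: (@le_trans _ _ (\sum_(s : {perm 'I_d}) (1 + (visits h)%:R) ^+ d)).
  apply: ler_sum => s _; rewrite normrM normrX normrN1 expr1n mul1r normr_prod.
  apply: (@le_trans _ _ (\prod_(i < d) (1 + (visits h)%:R))).
    by apply: ler_prod => i _; rewrite normr_ge0 gram_entry.
  by rewrite prodr_const card_ord.
rewrite sumr_const exprMn card_Sn -[leLHS]mulr_natl ler_wpM2r //.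
rewrite -natrX ler_nat.
rewrite fact_prod -[X in (_ <= d ^ X)%N](subn1 d.+1) -prod_nat_const_nat.
by rewrite big_nat [leqRHS]big_nat; apply: leq_prod => i /andP[_]; rewrite ltnS.
Qed.

(** Elliptical potential argument: an update with leverage [w] multiplies the determinant by
    [1 + w], and [w <= 2 ln (1 + w)] on [[0, 1]]. *)
Lemma sum_leverage h :
  \sum_(i < h | S i) leverage (gram i) (q i) <= 2 * ln (\det (gram h)).
Proof.
elim: h => [|h IH]; first by rewrite big_ord0 /gram big_ord0 addr0 det1 ln1 mulr0.
rewrite (big_ord_recr_cond S (fun i => leverage (gram i) (q i))) gramS.
case: ifP => Sh; last by rewrite !addr0.
rewrite det_rank1_update; [|exact: gram_sym|exact: gram_ge1].
have w0 : 0 <= leverage (gram h) (q h).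
  by apply: leverage_ge0; [exact: gram_sym|exact: gram_ge1].
have w1 : leverage (gram h) (q h) <= 1.
  by apply: leverage_le1; [exact: gram_sym|exact: gram_ge1|exact: q1].
rewrite lnM ?posrE ?det_gram_gt0 //; last by rewrite ltr_pwDl.
rewrite mulrDr lerD //.
set w := leverage _ _ in w0 w1 *.
(* From [expR (- (w / 2)) >= 1 - w / 2] and [(1 + w) (1 - w / 2) >= 1], valid for [w] in
   [[0, 1]]. *)
have : expR (w / 2) <= 1 + w.
  have e0 : 0 < expR (w / 2) by exact: expR_gt0.
  have := expR_ge1Dx (- (w / 2)); rewrite expRN.
  set e := expR _ in e0 * => h1.
  have : (1 - w / 2) * e <= 1.
    by rewrite -ler_pdivlMr // mul1r.
  nra.
rewrite -[1 + w]lnK ?posrE ?ltr_pwDl // ler_expR => h'; rewrite expRK; lra.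
Qed.
End Potential.

(** * Grid and single-round regret *)

Section Grid.
Variables (R : realType) (d : nat).

(** The mesh [1 / (d (t + 1))] shrinks with the number [t] of past visits, so that the squared
    rounding errors summed over those visits stay below 1. *)
Definition gridIdx t := {ffun 'I_d -> 'I_(2 * (d * t.+1)).+1}.

Definition gridPt t (k : gridIdx t) : 'cV[R]_d :=
  \col_i ((k i)%:R / (d * t.+1)%:R - 1).

Definition gridNear t (w : 'cV[R]_d) : gridIdx t :=
  [ffun i => inord (Num.truncn ((w i 0 + 1) * (d * t.+1)%:R))].

Lemma card_gridIdx t : #|{: gridIdx t}| = ((2 * (d * t.+1)).+1 ^ d)%N.
Proof. by rewrite card_ffun !card_ord. Qed.

Let K_gt0 (i : 'I_d) t : 0 < (d * t.+1)%:R :> R.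
Proof. by rewrite ltr0n muln_gt0 andbT (leq_ltn_trans _ (ltn_ord i)). Qed.

Lemma gridPt_norm t (k : gridIdx t) i : `|gridPt k i 0| <= 1.
Proof.
have K0 := K_gt0 i t.
rewrite mxE ler_norml; apply/andP; split.
  by rewrite lerBrDl addrN divr_ge0.
rewrite lerBlDr ler_pdivrMr // -[1 + 1]/(2%:R) -natrM ler_nat.
by rewrite -ltnS ltn_ord.
Qed.

Lemma gridNear_coord t (w : 'cV[R]_d) i : dotc w w <= 1 ->
  `|w i 0 - gridPt (gridNear t w) i 0| <= (d * t.+1)%:R^-1.
Proof.
move=> /(dotc_coord_le1 i); rewrite ler_norml => /andP[w1 w2].
have K0 := K_gt0 i t.
set K := (d * t.+1)%N in K0 *.
have s0 : 0 <= (w i 0 + 1) * K%:R by rewrite mulr_ge0 ?ler0n //; lra.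
have /andP[t1 t2] := truncn_itv s0.
have tK : (Num.truncn ((w i 0 + 1) * K%:R)%R < (2 * K).+1)%N.
  rewrite ltnS -(ler_nat R); apply: le_trans t1 _.
  by rewrite natrM ler_wpM2r ?ler0n //; lra.
rewrite mxE ffunE inordK // -/K.
set T := (Num.truncn _)%:R : R in t1 *.
have t2' : (w i 0 + 1) * K%:R < T + 1 by rewrite /T natr1.
have -> : w i 0 - (T / K%:R - 1) = ((w i 0 + 1) * K%:R - T) / K%:R.
  by field; rewrite gt_eqF.
rewrite normrM [X in _ * X]ger0_norm ?invr_ge0 ?(ltW K0) // -[leRHS]mul1r.
apply: ler_wpM2r; first by rewrite invr_ge0 ltW.
rewrite ler_norml; lra.
Qed.

(** Each of the [d] coordinates is off by at most the mesh, and
    [d / (d (t + 1))^2 <= 1 / (t + 1)^2]. *)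
Lemma gridNear_dist t (w : 'cV[R]_d) : dotc w w <= 1 ->
  dotc (w - gridPt (gridNear t w)) (w - gridPt (gridNear t w)) <= (t.+1%:R^-1) ^+ 2.
Proof.
move=> w1; set v := w - _.
have [d0|d0] := posnP d.
  rewrite /dotc big1 ?sqr_ge0 // => i _; have := ltn_ord i; lia.
apply: (@le_trans _ _ (\sum_(i < d) ((d * t.+1)%:R^-1) ^+ 2)).
  apply: ler_sum => i _; rewrite -expr2 -real_normK ?num_real //.
  by rewrite lerXn2r ?nnegrE // ?invr_ge0 // !mxE; have := gridNear_coord t i w1; rewrite mxE.
rewrite sumr_const card_ord natrM invfM exprMn -mulrnAl ler_piMl ?sqr_ge0 //.
rewrite -mulr_natl expr2 mulrA divff ?pnatr_eq0 -?lt0n // mul1r.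
by rewrite invf_le1 ?ltr0n // ler1n.
Qed.

Lemma grid_diff_le t (k k' : gridIdx t) :
  dotc (gridPt k - gridPt k') (gridPt k - gridPt k') <= 4 * d%:R.
Proof.
rewrite mulr_natr -[X in _ *+ X](card_ord d) -sumr_const.
apply: ler_sum => i _; rewrite -expr2 -real_normK ?num_real //.
rewrite (_ : 4 = 2 ^+ 2); last by rewrite expr2; lra.
rewrite lerXn2r ?nnegrE // mxE [X in _ + X]mxE.
apply: le_trans (ler_normB _ _) _.
by have := gridPt_norm k i; have := gridPt_norm k' i; lra.
Qed.
End Grid.

Section Round.
Variables (R : realType) (d b : nat) (Q : 'M[R]_(d, b)).
Hypothesis QQ : Q *m Q^T = 1%:M.

(** Pythagoras: [|x|^2 - |Q x|^2 = |x - Q^T Q x|^2]. *)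
Lemma orthonormal_contract x : dotc (Q *m x) (Q *m x) <= dotc x x.
Proof.
have E1 : dotc x (Q^T *m (Q *m x)) = dotc (Q *m x) (Q *m x).
  by rewrite dotc_mulmxr trmxK.
have E2 : dotc (Q^T *m (Q *m x)) (Q^T *m (Q *m x)) = dotc (Q *m x) (Q *m x).
  by rewrite dotc_mulmxr trmxK (mulmxA Q) QQ mul1mx.
have := dotc_ge0 (x - Q^T *m (Q *m x)).
rewrite dotcBl !dotcBr E2 (dotcC _ x) E1; lra.
Qed.

(* The tangent to [ln] at [#|I|] replaces Jensen's inequality for [E (ln (\sum_j expR (Y j)))]. *)
Lemma exp_max_le (I : finType) (Y : I -> R) (k : I) :
  Y k <= ln #|I|%:R - 1 + #|I|%:R^-1 * \sum_j expR (Y j).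
Proof.
set N := #|I|%:R : R.
have N0 : 0 < N by rewrite ltr0n; apply/card_gt0P; exists k.
have YS : expR (Y k) <= \sum_j expR (Y j).
  by rewrite (bigD1 k) //= lerDl sumr_ge0 // => j _; exact: expR_ge0.
have h : expR (Y k) / N <= N^-1 * \sum_j expR (Y j).
  by rewrite mulrC ler_pM2l ?invr_gt0.
have := expR_ge1Dx (Y k - ln N).
rewrite expRB lnK ?posrE // => h2; lra.
Qed.

Variables (h : nat) (S : pred nat).
Let t := visits S h.
(** The shift by one gives [gam = 1] at the first visit of a user. *)
Let gam : R := (Num.sqrt t.+1%:R)^-1.
Variables (m : 'cV[R]_b) (w : 'cV[R]_d) (a : nat -> 'cV[R]_b) (e : nat -> R).
Hypothesis w1 : dotc w w <= 1.
Hypothesis a1 : forall i, (i < h)%N -> S i -> dotc (a i) (a i) <= 1.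
Let theta := m + Q^T *m w.

Definition candidate (k : gridIdx d t) := m + Q^T *m gridPt R k.
Definition sqloss (k : gridIdx d t) :=
  \sum_(i < h | S i) (dotc (a i) theta + e i - dotc (a i) (candidate k)) ^+ 2.
(** Exponent of the exponential supermartingale with tilt [<Q a_i, v - w'> / 2], where [w'] is the
    grid point next to [w]. It involves the unknown [w]: it serves the analysis, and the policy
    never evaluates it. *)
Definition logweight (k : gridIdx d t) :=
  \sum_(i < h | S i) (dotc (Q *m a i) (gridPt R k - gridPt R (gridNear t w)) / 2 * e i
     - (dotc (Q *m a i) (gridPt R k - gridPt R (gridNear t w)) / 2) ^+ 2 / 2).

Lemma round_regret (x x' : 'cV[R]_b) (k : gridIdx d t) :
  dotc x x <= 1 -> dotc x' x' <= 1 ->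
  (forall k', dotc x' (candidate k') - gam * sqloss k' <=
              dotc x (candidate k) - gam * sqloss k) ->
  dotc x' theta - dotc x theta <=
    gam * (2 + d%:R + 4 * (d%:R * ln (2 * (d * t.+1)).+1%:R)) +
    gam^-1 * leverage (gram (fun i => Q *m a i) S h) (Q *m x) +
    4 * gam * (#|{: gridIdx d t}|%:R^-1 * \sum_k' expR (logweight k')).
Proof.
move=> x1 x'1 opt.
have T0 : 0 < t.+1%:R :> R by rewrite ltr0n.
have T1 : 1 <= t.+1%:R :> R by rewrite ler1n.
have gam0 : 0 < gam by rewrite invr_gt0 sqrtr_gt0.
have gamT : t.+1%:R^-1 <= gam.
  rewrite lef_pV2 ?posrE ?sqrtr_gt0 // -{2}(sqr_sqrtr (ltW T0)) expr2.
  by rewrite ler_peMl ?sqrtr_ge0 // -{1}sqrtr1 ler_sqrt.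
set w' := gridNear t w in opt *.
pose dw := w - gridPt R w'; pose z := gridPt R k - gridPt R w'.
have dwle : dotc dw dw <= t.+1%:R^-1 ^+ 2 by exact: gridNear_dist.
have Qle y : dotc y y <= 1 -> dotc (Q *m y) dw ^+ 2 <= t.+1%:R^-1 ^+ 2.
  move=> y1; apply: le_trans (CauchySchwarz_dotc _ _) _.
  apply: le_trans dwle; rewrite -[leRHS]mul1r ler_wpM2r ?dotc_ge0 //.
  exact: le_trans (orthonormal_contract _) y1.
have Qle1 y : dotc y y <= 1 -> `|dotc (Q *m y) dw| <= gam.
  move=> y1; apply: le_trans gamT.
  rewrite -(ler_pXn2r (n := 2)) ?nnegrE ?invr_ge0 ?(ltW T0) //.
  by rewrite real_normK ?num_real // Qle.
have candE y k' : dotc y (candidate k') = dotc y m + dotc (Q *m y) (gridPt R k').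
  by rewrite dotcDr dotc_mulmxr trmxK.
have thE y : dotc y theta = dotc y m + dotc (Q *m y) w.
  by rewrite dotcDr dotc_mulmxr trmxK.
pose g i := dotc (Q *m a i) z.
have lossdiff : sqloss w' - sqloss k <=
    4 * (logweight k + 1) - 4^-1 * \sum_(i < h | S i) g i ^+ 2.
  (* There are [t] visits, each contributing at most [1 / (t + 1)^2]. *)
  have : \sum_(i < h | S i) dotc (Q *m a i) dw ^+ 2 <= 1.
    apply: (@le_trans _ _ (\sum_(i < h | S i) t.+1%:R^-1 ^+ 2)).
      by apply: ler_sum => i Si; apply: Qle; exact: a1.
    rewrite sumr_const -[X in _ *+ X]sum1_card.
    have -> : (\sum_(i < h | i \in (fun j : 'I_h => S j)) 1)%N = t.
      rewrite /t /visits [RHS]big_mkcond [LHS]big_mkcond /=; apply: eq_bigr => i _.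
      by rewrite unfold_in; case: (S i).
    rewrite -[leLHS]mulr_natl expr2 mulrA ler_pdivrMr // mul1r.
    apply: (@le_trans _ _ 1); last by [].
    by rewrite ler_pdivrMr // mul1r ler_nat.
  move=> dw1.
  apply: (@le_trans _ _ (\sum_(i < h | S i)
     (4 * (g i / 2 * e i - (g i / 2) ^+ 2 / 2) - 4^-1 * g i ^+ 2
      + 4 * dotc (Q *m a i) dw ^+ 2))).
    rewrite /sqloss -sumrB; apply: ler_sum => i Si.
    rewrite !candE !thE /g /z !dotcBr /dw ?dotcBr.
    set p := dotc _ m; set q := dotc _ w; set r := dotc _ (gridPt R w').
    set s := dotc _ (gridPt R k).
    (* With [delta = q - r] and [g = s - r] the loss difference is [2 g e + 2 g delta - g^2], and
       the slack in the bound is [(4 delta - g)^2 / 4]. *)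
    have := sqr_ge0 (4 * (q - r) - (s - r)); nra.
  rewrite big_split /= sumrB -!mulr_sumr /logweight -/w'; move: dw1; lra.
have := opt w'; rewrite !candE !thE => opt'.
have lev := @dotc_leverage R d (gram (fun i => Q *m a i) S h)
  (gram_sym _ _ _) (gram_ge1 _ _ _) gam (Q *m x) z gam0.
rewrite gram_quad in lev.
have zz := grid_diff_le R k w'; rewrite -/z in zz.
have Yk := exp_max_le logweight k.
have lnN : ln #|{: gridIdx d t}|%:R = d%:R * ln (2 * (d * t.+1)).+1%:R :> R.
  by rewrite card_gridIdx natrX lnXn ?ltr0n // mulr_natl.
rewrite {}lnN in Yk.
have /ler_normlP[] := Qle1 _ x'1; have /ler_normlP[] := Qle1 _ x1.
have zE : dotc (Q *m x) z = dotc (Q *m x) (gridPt R k) - dotc (Q *m x) (gridPt R w').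
  exact: dotcBr.
rewrite /dw !dotcBr.
(* The 2 pays for rounding [w] against [x] and [x'], the [d] comes from [|z|^2 <= 4 d], and the
   [+ 1] of [lossdiff] cancels the [- 1] of [exp_max_le]. *)
have h1 := ler_wpM2l (ltW gam0) lossdiff.
have h2 := ler_wpM2l (ltW gam0) Yk.
have h3 := ler_wpM2l (ltW gam0) zz.
move: opt' lev h1 h2 h3; rewrite zE.
lra.
Qed.
End Round.

(** * The policy *)

Section FinMeas.
Context (R : realType) (dd : measure_display) (Omega : measurableType dd).

(** Every function of such a map is measurable, with no sigma-algebra placed on the target. This
    suits actions, which take finitely many values. *)
Definition fin_meas (T : choiceType) (f : Omega -> T) :=
  (exists s : seq T, forall w, f w \in s) /\
  forall x, measurable (f @^-1` [set x]).

Lemma fin_meas_preimage (T : choiceType) (f : Omega -> T) (A : set T) :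
  fin_meas f -> measurable (f @^-1` A).
Proof.
move=> [[s fs] mf].
have -> : f @^-1` A = \big[setU/set0]_(x <- [seq x <- s | x \in A]) (f @^-1` [set x]).
  rewrite -bigcup_seq; apply/seteqP; split => w /=.
    by move=> Afw; exists (f w) => //=; rewrite mem_filter fs andbT; exact: mem_set.
  by move=> [x /=]; rewrite mem_filter => /andP[/set_mem Ax _] ->.
by apply: bigsetU_measurable.
Qed.

Lemma fin_meas_cst (T : choiceType) (x : T) : fin_meas (fun=> x).
Proof.
split; first by exists [:: x] => w; rewrite inE.
by move=> y; rewrite preimage_cst; case: ifP.
Qed.

Lemma fin_meas_comp (T T' : choiceType) (g : T -> T') (f : Omega -> T) :
  fin_meas f -> fin_meas (g \o f).
Proof.
move=> mf; split.
  by have [[s fs] _] := mf; exists (map g s) => w; exact: map_f.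
by move=> y; rewrite comp_preimage; exact: fin_meas_preimage.
Qed.

(** The space is cut into the fibres of [f], on each of which [F (f w)] is a fixed map. This handles
    actions that depend on earlier actions. *)
Lemma fin_meas_bind (T T' : choiceType) (f : Omega -> T) (F : T -> Omega -> T') :
  fin_meas f -> (forall a, fin_meas (F a)) -> fin_meas (fun w => F (f w) w).
Proof.
move=> mf mF; have [[s fs] ms] := mf.
have [r rP] := choice (fun a => (mF a).1).
split.
  by exists (flatten (map r s)) => w; apply/flatten_mapP; exists (f w).
move=> y.
have -> : (fun w => F (f w) w) @^-1` [set y] =
    \big[setU/set0]_(a <- s) (f @^-1` [set a] `&` F a @^-1` [set y]).
  rewrite -bigcup_seq; apply/seteqP; split => w /=.
    by move=> <-; exists (f w) => //=.
  by move=> [a _ [/= <-]].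
apply: bigsetU_measurable => a _; apply: measurableI => //.
exact: (mF a).2.
Qed.

(** An argmax depends on real scores only through finitely many comparisons; the table of their
    outcomes is treated as one map. *)
Lemma fin_meas_ffun (I : finType) (B : I -> Omega -> bool) :
  (forall i, measurable_fun setT (B i)) -> fin_meas (fun w => [ffun i => B i w]).
Proof.
move=> mB; split.
  by exists (enum {ffun I -> bool}) => w; rewrite mem_enum.
move=> g.
have -> : (fun w => [ffun i => B i w]) @^-1` [set g] =
    \big[setI/setT]_(i <- enum I) (B i @^-1` [set g i]).
  rewrite -bigcap_seq; apply/seteqP; split => w /=.
    by move=> <- i _ /=; rewrite ffunE.
  by move=> h; apply/ffunP => i; rewrite ffunE; apply: (h i) => /=; rewrite mem_enum.
apply: bigsetI_measurable => i _.
by rewrite -[X in measurable X]setTI; exact: mB.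
Qed.

Lemma fin_meas_forall (I : finType) (B : I -> Omega -> bool) :
  (forall i, measurable_fun setT (B i)) ->
  measurable_fun setT (fun w => [forall i, B i w]).
Proof.
move=> mB.
have -> : (fun w => [forall i, B i w]) =
    (fun g : {ffun I -> bool} => [forall i, g i]) \o (fun w => [ffun i => B i w]).
  by apply/funext => w /=; apply: eq_forallb => i; rewrite ffunE.
move=> _ Y _; rewrite setTI.
by apply: fin_meas_preimage; apply: fin_meas_comp; exact: fin_meas_ffun.
Qed.

Lemma fin_meas_measurable (T : choiceType) (d' : measure_display) (T' : measurableType d')
    (g : T -> T') (f : Omega -> T) : fin_meas f -> measurable_fun setT (g \o f).
Proof. by move=> mf _ Y _; rewrite setTI comp_preimage; exact: fin_meas_preimage. Qed.
End FinMeas.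

Section Policy.
Variables (R : realType) (d b U : nat) (Q : 'M[R]_(d, b)) (m : 'I_U -> 'cV[R]_b).

(* Truncated at [h] so that it depends on no user arriving after round [h]. *)
Definition sameUser (us : nat -> 'I_U) h : pred nat :=
  fun i => (i < h)%N && (us i == us h).

Definition score (h : nat) (S : pred nat) (mu x : 'cV[R]_b) (acts : seq 'cV[R]_b)
    (f : nat -> R) (k : gridIdx d (visits S h)) : R :=
  dotc x (candidate Q mu k) -
  (Num.sqrt (visits S h).+1%:R)^-1 *
  \sum_(i < h | S i) (f i - dotc (nth 0 acts i) (candidate Q mu k)) ^+ 2.

(** The argument is a Boolean table and not the scores, so that the choice factors through a map
    with finitely many values. In [choose] the default [0] occurs only for an empty decision set. *)
Definition best_action (D : seq 'cV[R]_b) (K : finType)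
    (best : 'I_(size D) * K -> bool) : 'cV[R]_b :=
  if [pick p | best p] is Some p then nth 0 D p.1 else 0.

Definition choose (h : nat) (S : pred nat) (mu : 'cV[R]_b) (D acts : seq 'cV[R]_b)
    (f : nat -> R) : 'cV[R]_b :=
  best_action (fun p : 'I_(size D) * gridIdx d (visits S h) =>
    [forall p' : 'I_(size D) * gridIdx d (visits S h),
      score mu (nth 0 D p'.1) acts f p'.2 <= score mu (nth 0 D p.1) acts f p.2]).

Definition user_choose h us D acts f := choose h (sameUser us h) (m (us h)) D acts f.

(** A policy receives the rewards but not its own earlier actions, so these are replayed from the
    rewards. *)
Fixpoint past_actions (h : nat) (us : nat -> 'I_U) (Ds : nat -> seq 'cV[R]_b)
    (f : nat -> R) : seq 'cV[R]_b :=
  if h is h'.+1 then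
    let acts := past_actions h' us Ds f in rcons acts (user_choose h' us (Ds h') acts f)
  else [::].

Definition optimistic_policy : policy R b U :=
  fun h us Ds f => user_choose h us (Ds h) (past_actions h us Ds f) f.

Lemma user_choose_causal h us us' D acts f f' :
  (forall i, (i <= h)%N -> us i = us' i) -> (forall i, (i < h)%N -> f i = f' i) ->
  user_choose h us D acts f = user_choose h us' D acts f'.
Proof.
move=> hus hf; rewrite /user_choose hus //.
(* The predicates must be equal as functions, because the type of the grid depends on them. *)
have -> : sameUser us h = sameUser us' h.
  apply/funext => i; rewrite /sameUser (hus h) //.
  by case: ltnP => //= ih; rewrite hus // ltnW.
rewrite /choose; congr best_action; apply/funext => p; apply: eq_forallb => p'.
have sE x (k : gridIdx d (visits (sameUser us' h) h)) :
    score (m (us' h)) x acts f k = score (m (us' h)) x acts f' k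
    :> R.
  rewrite /score; congr (_ - _ * _); apply: eq_bigr => i _. by rewrite (hf _ (ltn_ord i)).
by rewrite !sE.
Qed.

Lemma past_actions_causal h us us' Ds Ds' f f' :
  (forall i, (i < h)%N -> us i = us' i) -> (forall i, (i < h)%N -> Ds i = Ds' i) ->
  (forall i, (i < h)%N -> f i = f' i) ->
  past_actions h us Ds f = past_actions h us' Ds' f'.
Proof.
elim: h => //= h IH hus hDs hf.
rewrite IH; [|by move=> i ih; apply: hus; exact: ltnW|
  by move=> i ih; apply: hDs; exact: ltnW|by move=> i ih; apply: hf; exact: ltnW].
rewrite hDs //; congr rcons; apply: user_choose_causal => i ih; first exact: hus.
by apply: hf; exact: ltnW.
Qed.

Lemma optimistic_policy_causal : causal optimistic_policy.
Proof.
move=> h us us' Ds Ds' f f' hus hDs hf; rewrite /optimistic_policy hDs //.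
have -> : past_actions h us Ds f = past_actions h us' Ds' f'.
  by apply: past_actions_causal => // i /ltnW ih; [exact: hus|exact: hDs].
exact: user_choose_causal.
Qed.

Lemma size_past_actions h us Ds f : size (past_actions h us Ds f) = h.
Proof. by elim: h => //= h IH; rewrite size_rcons IH. Qed.

Lemma nth_past_actions h us Ds f i : (i < h)%N ->
  nth 0 (past_actions h us Ds f) i = optimistic_policy i us Ds f.
Proof.
elim: h => //= h IH; rewrite ltnS leq_eqVlt nth_rcons size_past_actions.
by case: eqP => [-> _|_ /= ih]; rewrite ?ltnn // ih IH.
Qed.

Lemma choose_optimal h S mu D acts f : D != [::] ->
  choose h S mu D acts f \in D /\
  exists k : gridIdx d (visits S h), forall x' (k' : gridIdx d (visits S h)), x' \in D ->
    score mu x' acts f k' <= score mu (choose h S mu D acts f) acts f k.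
Proof.
move=> D0; rewrite /choose /best_action.
have sD : (0 < size D)%N by rewrite lt0n size_eq0.
case: pickP => [p /forallP bp|none].
  split; first exact: mem_nth.
  exists p.2 => x' k' x'D; have := bp (Ordinal (etrans (index_mem x' D) x'D), k').
  by rewrite /= nth_index.
pose p0 : 'I_(size D) * gridIdx d (visits S h) := (Ordinal sD, [ffun=> ord0]).
case: (@arg_maxP _ _ _ p0 xpredT (fun p => score mu (nth 0 D p.1) acts f p.2) isT) => p _ bp.
by have /negP[] := none p; apply/forallP => p'; exact: bp.
Qed.
End Policy.

(** * Interaction *)

Section Interaction.
Variables (R : realType) (n d b U : nat) (Q : 'M[R]_(d, b)) (m : 'I_U -> 'cV[R]_b).
Variables (B : 'M[R]_(b, n)) (th : 'I_U -> 'cV[R]_n).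
Variables (us : nat -> 'I_U) (Ds : nat -> seq 'cV[R]_b).

Local Notation pol := (optimistic_policy Q m).

Section Pathwise.
Variables (Omega : Type) (eta : nat -> Omega -> R).
Local Notation hist := (hist B th pol us Ds eta).
Local Notation action := (action B th pol us Ds eta).
Local Notation X := (X B th pol us Ds eta).

Lemma hist_lt h i w : (i < h)%N -> hist h w i = X i w.
Proof.
elim: h => //= h IH; rewrite ltnS leq_eqVlt; case: eqP => [->|_ /=] //.
Qed.

(** The replay sees the longer history [hist h w], but by causality only its entries before [i]
    matter, and these agree with [hist i w]. *)
Lemma past_actions_hist h i w : (i < h)%N ->
  nth 0 (past_actions Q m h us Ds (hist h w)) i = action i w.
Proof.
move=> ih; rewrite nth_past_actions //.
apply: (@optimistic_policy_causal R d b U Q m) => // j ji.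
by rewrite !hist_lt // (ltn_trans ji).
Qed.

(** The selected rounds belong to user [us h], so their rewards share one parameter and the penalty
    takes the form of [sqloss]. *)
Lemma score_hist h w x mu (k : gridIdx d (visits (sameUser us h) h)) :
  score Q mu x (past_actions Q m h us Ds (hist h w)) (hist h w) k =
  dotc x (candidate Q mu k) - (Num.sqrt (visits (sameUser us h) h).+1%:R)^-1 *
  \sum_(i < h | sameUser us h i) (dotc (action i w) (B *m th (us h)) + eta i w
     - dotc (action i w) (candidate Q mu k)) ^+ 2.
Proof.
rewrite /score; congr (_ - _ * _); apply: eq_bigr => i /andP[_ /eqP ui].
by rewrite past_actions_hist // hist_lt // -ui.
Qed.

Lemma action_in h w : Ds h != [::] -> action h w \in Ds h.
Proof. by move=> D0; have [] := choose_optimal Q h (sameUser us h) (m (us h))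
  (past_actions Q m h us Ds (hist h w)) (hist h w) D0. Qed.

Lemma action_optimal h w : Ds h != [::] ->
  exists k : gridIdx d (visits (sameUser us h) h),
  forall x' (k' : gridIdx d (visits (sameUser us h) h)), x' \in Ds h ->
    score Q (m (us h)) x' (past_actions Q m h us Ds (hist h w)) (hist h w) k' <=
    score Q (m (us h)) (action h w) (past_actions Q m h us Ds (hist h w)) (hist h w) k.
Proof. by move=> D0; have [] := choose_optimal Q h (sameUser us h) (m (us h))
  (past_actions Q m h us Ds (hist h w)) (hist h w) D0. Qed.
End Pathwise.

Section Measurability.
Context (dd : measure_display) (Omega : measurableType dd) (eta : nat -> Omega -> R).
Local Notation hist := (hist B th pol us Ds eta).
Local Notation action := (action B th pol us Ds eta).
Local Notation X := (X B th pol us Ds eta).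

Lemma fin_meas_user_choose h acts (f : Omega -> nat -> R) :
  (forall i, (i < h)%N -> measurable_fun setT (f ^~ i)) ->
  fin_meas (fun w => user_choose Q m h us (Ds h) acts (f w)).
Proof.
move=> mf; rewrite /user_choose /choose.
set S := sameUser us h; set mu := m (us h).
pose bs w (p : 'I_(size (Ds h)) * gridIdx d (visits S h)) :=
  [forall p' : 'I_(size (Ds h)) * gridIdx d (visits S h),
   score Q mu (nth 0 (Ds h) p'.1) acts (f w) p'.2 <=
   score Q mu (nth 0 (Ds h) p.1) acts (f w) p.2].
have -> : (fun w => best_action (bs w)) = (fun g : {ffun _ -> bool} => best_action g) \o
    (fun w => [ffun p => bs w p]).
  by apply/funext => w /=; congr best_action; apply/funext => p; rewrite ffunE.
apply: fin_meas_comp; apply: (fin_meas_ffun (B := fun p w => bs w p)) => p.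
apply: (fin_meas_forall (B := fun (p' : 'I_(size (Ds h)) * gridIdx d (visits S h)) w =>
   score Q mu (nth 0 (Ds h) p'.1) acts (f w) p'.2 <=
   score Q mu (nth 0 (Ds h) p.1) acts (f w) p.2)) => p'.
have ms x (k : gridIdx d (visits S h)) : measurable_fun setT (fun w => score Q mu x acts (f w) k).
  apply: measurable_funB => //; apply: measurable_funM => //.
  rewrite (_ : (fun w => _) = (fun w => \sum_(i < h) if S i then
     (f w i - dotc (nth 0 acts i) (candidate Q mu k)) ^+ 2 else 0)); last first.
    by apply/funext => w; rewrite big_mkcond.
  apply: measurable_sum => i; case: (S i) => //.
  by apply: measurable_funX; apply: measurable_funB => //; exact: mf.
exact: measurable_fun_ler.
Qed.

(** Strong induction: past rewards are functions of past actions plus noise, and for each value of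
    the past actions the choice is a table of comparisons. As [Omega] is arbitrary, the
    sigma-algebra of the past noise is covered too, which gives predictability. *)
Lemma fin_meas_action h : (forall i, (i < h)%N -> measurable_fun setT (eta i)) ->
  fin_meas (action h).
Proof.
elim/ltn_ind: h => h IH meta.
have macts k : (k <= h)%N -> fin_meas (fun w => mkseq (fun i => action i w) k).
  elim: k => [|k IHk] kh; first exact: fin_meas_cst.
  have -> : (fun w => mkseq (fun i => action i w) k.+1) =
      (fun w => rcons (mkseq (fun i => action i w) k) (action k w)).
    by apply/funext => w; rewrite mkseqS.
  apply: (fin_meas_bind (F := fun a w => rcons a (action k w)) (IHk (ltnW kh))) => a.
  by apply: (fin_meas_comp (rcons a)); apply: IH => // i ik; apply: meta; exact: ltn_trans kh.
have pastE w : past_actions Q m h us Ds (hist h w) = mkseq (fun i => action i w) h.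
  apply: (@eq_from_nth _ 0); rewrite size_past_actions ?size_mkseq // => i ih.
  by rewrite nth_mkseq // past_actions_hist.
have actE : action h = fun w => user_choose Q m h us (Ds h)
    (mkseq (fun i => action i w) h) (hist h w).
  by apply/funext => w; rewrite -pastE.
rewrite actE.
apply: (fin_meas_bind (F := fun a w => user_choose Q m h us (Ds h) a (hist h w))).
  exact: macts.
move=> acts; apply: fin_meas_user_choose => i ih.
have -> : (fun w => hist h w i) =
    (fun w => dotc (action i w) (B *m th (us i)) + eta i w).
  by apply/funext => w; rewrite hist_lt.
apply: measurable_funD; last exact: meta.
apply: (fin_meas_measurable (fun x => dotc x (B *m th (us i)))).
by apply: IH => // j ji; apply: meta; exact: ltn_trans ih.
Qed.
End Measurability.
End Interaction.

(** * Summation over rounds and users *)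

Section UserSums.
Variables (R : realType) (S : pred nat).
Local Notation T := (visits S).

Lemma visits_lt h H : (h < H)%N -> S h -> (T h < T H)%N.
Proof.
move=> hH Sh; have <- : T h.+1 = (T h).+1 by rewrite visitsS Sh addn1.
rewrite -(subnK hH); elim: (H - h.+1)%N => // k IH.
by rewrite addSn [leqRHS]visitsS; apply: leq_trans IH _; exact: leq_addr.
Qed.

(** Telescoping with [1 / c <= 2 (c - a)] for [c^2 = a^2 + 1]; multiplied by [c], the slack is
    [(c - a)^2]. *)
Lemma sum_inv_sqrt_visits H :
  \sum_(h < H | S h) (Num.sqrt (T h).+1%:R)^-1 <= 2 * Num.sqrt (T H)%:R :> R.
Proof.
elim: H => [|h IH]; first by rewrite big_ord0 mulr_ge0 // sqrtr_ge0.
rewrite (big_ord_recr_cond S (fun h => (Num.sqrt (T h).+1%:R)^-1)) visitsS.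
case: ifP => Sh; last by rewrite addr0 addn0.
rewrite addn1; apply: le_trans (lerD IH (lexx _)) _.
set a := Num.sqrt (T h)%:R : R; set c := Num.sqrt (T h).+1%:R : R.
have c0 : 0 < c by rewrite sqrtr_gt0 ltr0n.
have a0 : 0 <= a by exact: sqrtr_ge0.
have ac : c ^+ 2 = a ^+ 2 + 1 by rewrite !sqr_sqrtr ?ler0n // -natr1.
rewrite -(ler_pM2r c0) mulrDl mulVf ?gt_eqF //.
have : 0 <= (c - a) ^+ 2 by exact: sqr_ge0.
nra.
Qed.

Variables (d : nat) (q : nat -> 'cV[R]_d).
Hypothesis d0 : (0 < d)%N.
Hypothesis q1 : forall i, S i -> dotc (q i) (q i) <= 1.

(** The 6 is the 2 of [round_regret] plus 4 for the expected mixture. The logarithm [L] dominates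
    both that of the grid size and that of the determinant, so the two sums give
    [2 sT (6 + d + 4 d L)] and [2 sT d L]; then [d >= 1] is used. *)
Lemma user_regret_bound H : (0 < T H)%N ->
  \sum_(h < H | S h) ((Num.sqrt (T h).+1%:R)^-1 *
      (6 + d%:R + 4 * (d%:R * ln (2 * (d * (T h).+1)).+1%:R)) +
    ((Num.sqrt (T h).+1%:R)^-1)^-1 * leverage (gram q S h) (q h)) <=
  d%:R * Num.sqrt (T H)%:R * (14 + 10 * ln (3 * (d * T H))%:R).
Proof.
move=> TH0; rewrite big_split /=.
have dR1 : 1 <= d%:R :> R by rewrite ler1n.
set L := ln _; set sT := Num.sqrt (T H)%:R.
have sT0 : 0 <= sT by exact: sqrtr_ge0.
have L0 : 0 <= L by rewrite ln_ge0 // ler1n !muln_gt0 d0 TH0.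
have lnle k : (0 < k <= 3 * (d * T H))%N -> ln k%:R <= L.
  by move=> /andP[k0 kT]; rewrite ler_ln ?posrE ?ltr0n ?ler_nat // !muln_gt0 d0 TH0.
have h1 : \sum_(h < H | S h) ((Num.sqrt (T h).+1%:R)^-1 *
      (6 + d%:R + 4 * (d%:R * ln (2 * (d * (T h).+1)).+1%:R))) <=
    2 * sT * (6 + d%:R + 4 * (d%:R * L)).
  apply: (@le_trans _ _ (\sum_(h < H | S h) ((Num.sqrt (T h).+1%:R)^-1 *
      (6 + d%:R + 4 * (d%:R * L))))).
    apply: ler_sum => h Sh; rewrite ler_wpM2l ?invr_ge0 ?sqrtr_ge0 //.
    rewrite lerD2l ler_pM2l // ler_wpM2l //.
    apply: lnle => /=; have := visits_lt (ltn_ord h) Sh; nia.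
  rewrite -mulr_suml ler_wpM2r ?sum_inv_sqrt_visits //.
  by rewrite addr_ge0 ?addr_ge0 ?mulr_ge0.
have h2 : \sum_(h < H | S h) (((Num.sqrt (T h).+1%:R)^-1)^-1 * leverage (gram q S h) (q h)) <=
    sT * (2 * (d%:R * L)).
  apply: (@le_trans _ _ (\sum_(h < H | S h) (sT * leverage (gram q S h) (q h)))).
    apply: ler_sum => h Sh; rewrite invrK ler_wpM2r //.
      by apply: leverage_ge0; [exact: gram_sym|exact: gram_ge1].
    by rewrite ler_sqrt ?ler0n // ler_nat; exact: visits_lt.
  rewrite -mulr_sumr ler_wpM2l //.
  apply: le_trans (@sum_leverage R d q S q1 H) _; rewrite ler_pM2l //.
  have dd0 := @det_gram_gt0 R d q S H.
  have dd := @det_gram_le R d q S q1 H.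
  apply: (@le_trans _ _ (ln ((d * (T H).+1)%:R ^+ d))).
    by rewrite ler_ln ?posrE ?exprn_gt0 ?ltr0n ?muln_gt0 ?d0 // natrM -(natr1 (T H)) [_ + 1]addrC.
  rewrite lnXn ?ltr0n ?muln_gt0 ?d0 // -[leLHS]mulr_natl ler_wpM2l //.
  by apply: lnle; rewrite muln_gt0 d0 /=; nia.
apply: le_trans (lerD h1 h2) _.
have := mulr_ge0 sT0 L0; have := mulr_ge0 (mulr_ge0 (ler0n R d) sT0) L0.
have : 0 <= sT * (d%:R - 1) by rewrite mulr_ge0 // subr_ge0.
lra.
Qed.
End UserSums.

(** * Logarithmic estimates and the sum over users *)

Section Numeric.
Variable R : realType.

(** Together with [2 U <= H] this bounds the logarithm of the theorem below by 1/2, so that it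
    absorbs additive constants. *)
Lemma ln2_ge_half : 1 / 2 <= ln 2 :> R.
Proof.
have e0 : 0 < expR (1 / 2 : R) by exact: expR_gt0.
rewrite -[leLHS]expRK ler_ln ?posrE //.
have := expR_ge1Dx (- (1 / 2 : R)); rewrite expRN => h.
have := ler_pM2r e0 (1 + - (1 / 2)) (expR (1 / 2))^-1.
rewrite h mulVf ?gt_eqF // => h2; lra.
Qed.

Lemma ln3_le2 : ln 3 <= 2 :> R.
Proof.
rewrite -[leRHS]expRK ler_ln ?posrE ?expR_gt0 //.
by have := expR_ge1Dx (2 : R); lra.
Qed.

(** With [s = sqrt T_u], [ln T_u = l + 2 ln (s rho)] and [ln x <= x] trade the visits of a user for
    [l], and [ln d <= l / 2] since [d^2 U <= H]. The total is [d H rho (54 + 15 l)], and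
    [54 <= 108 l] gives 123. *)
Lemma sum_user_regret_le (U H d : nat) (Tu : 'I_U -> nat) (l : R) :
  (0 < U)%N -> (0 < H)%N -> (0 < d)%N -> (d ^ 2 * U <= H)%N ->
  l = ln (H%:R / U%:R) -> 1 / 2 <= l -> (\sum_u Tu u = H)%N ->
  \sum_(u | (0 < Tu u)%N) (d%:R * Num.sqrt (Tu u)%:R * (14 + 10 * ln (3 * (d * Tu u))%:R)) <=
  123 * d%:R * Num.sqrt (U%:R * H%:R) * l.
Proof.
move=> U0 H0 d0 dUH lE l2 sumT.
have UR : 0 < U%:R :> R by rewrite ltr0n.
have HR : 0 < H%:R :> R by rewrite ltr0n.
have dR : 0 < d%:R :> R by rewrite ltr0n.
(* The weight that balances AM-GM [s <= (s^2 rho + 1 / rho) / 2] after summation: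
   [U / rho = H rho = sqrt (U H)]. *)
pose rho : R := Num.sqrt (U%:R / H%:R).
have rho0 : 0 < rho by rewrite sqrtr_gt0 divr_gt0.
have rho2 : rho ^+ 2 = U%:R / H%:R by rewrite sqr_sqrtr // ltW // divr_gt0.
have UHrho : Num.sqrt (U%:R * H%:R) = H%:R * rho.
  rewrite -[X in X * rho]ger0_norm ?ler0n // -sqrtr_sqr /rho -sqrtrM ?sqr_ge0 //.
  by congr Num.sqrt; field; rewrite gt_eqF.
have Urho : U%:R / rho = H%:R * rho.
  apply: (mulIf (lt0r_neq0 rho0)); rewrite divfK ?gt_eqF // -mulrA -expr2 rho2.
  by field; rewrite gt_eqF.
have lnd : ln d%:R <= l / 2.
  have : ln (d%:R ^+ 2) <= l :> R.
    rewrite lE ler_ln ?posrE ?exprn_gt0 ?divr_gt0 // ler_pdivlMr //.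
    by rewrite -natrX -natrM ler_nat.
  by rewrite lnXn //; lra.
have ln3 := ln3_le2.
have term u : (0 < Tu u)%N ->
   d%:R * Num.sqrt (Tu u)%:R * (14 + 10 * ln (3 * (d * Tu u))%:R) <=
   d%:R * ((34 + 15 * l) * (((Tu u)%:R * rho + rho^-1) / 2) + 20 * ((Tu u)%:R * rho)).
  move=> T0; have TR : 0 < (Tu u)%:R :> R by rewrite ltr0n.
  rewrite -mulrA ler_pM2l //.
  set s := Num.sqrt (Tu u)%:R.
  have s0 : 0 < s by rewrite sqrtr_gt0.
  have s2 : s ^+ 2 = (Tu u)%:R by rewrite sqr_sqrtr ?ler0n.
  have lnT : ln (Tu u)%:R = l + 2 * ln (s * rho).
    rewrite lE -s2 lnXn // [ln (s * rho)]lnM ?posrE // mulrDr.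
    have -> : H%:R / U%:R = (rho ^+ 2)^-1 by rewrite rho2 invf_div.
    by rewrite lnV ?posrE ?exprn_gt0 // lnXn //; lra.
  have lns : ln (s * rho) <= s * rho.
    have sr : 0 < s * rho by rewrite mulr_gt0.
    have := expR_ge1Dx (ln (s * rho)); rewrite lnK ?posrE //; lra.
  rewrite !natrM !lnM ?posrE ?mulr_gt0 ?ltr0n //.
  have amgm : s <= ((Tu u)%:R * rho + rho^-1) / 2.
    rewrite -s2 -(ler_pM2r rho0).
    have -> : (s ^+ 2 * rho + rho^-1) / 2 * rho = ((s * rho) ^+ 2 + 1) / 2.
      by field; rewrite gt_eqF.
    have := sqr_ge0 (s * rho - 1); lra.
  have k0 : 0 <= 34 + 15 * l by lra.
  have m1 := ler_wpM2l k0 amgm.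
  have m2 := ler_wpM2l (ltW s0) lns.
  have m3 : s * (14 + 10 * (ln 3 + (ln d%:R + ln (Tu u)%:R))) <=
     s * (14 + 10 * (2 + (l / 2 + (l + 2 * ln (s * rho))))).
    rewrite ler_pM2l //; rewrite lnT; lra.
  have m4 : s * (s * rho) = (Tu u)%:R * rho by rewrite mulrA -expr2 s2.
  rewrite m4 in m2; move: m1 m2 m3; lra.
apply: (@le_trans _ _ (\sum_u
   d%:R * ((34 + 15 * l) * (((Tu u)%:R * rho + rho^-1) / 2) + 20 * ((Tu u)%:R * rho)))).
  rewrite big_mkcond /=; apply: ler_sum => u _; case: ifP => T0; first exact: term.
  have -> : Tu u = 0%N by lia.
  rewrite mul0r add0r mulr0 addr0 !mulr_ge0 ?invr_ge0 ?(ltW rho0) //; lra.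
rewrite -mulr_sumr big_split /= -!mulr_sumr -mulr_suml big_split /= sumr_const card_ord.
rewrite -mulr_suml -natr_sum sumT -[rho^-1 *+ U]mulr_natl Urho UHrho.
have : 0 <= d%:R * (H%:R * rho) * (l - 1 / 2).
  by rewrite !mulr_ge0 ?ler0n ?(ltW rho0) // subr_ge0.
lra.
Qed.
End Numeric.

(** * Expected regret *)

Lemma maxover_attained (R : realType) k (s : seq 'cV[R]_k) f : s != [::] ->
  exists2 x, x \in s & maxover s f = f x.
Proof.
move=> s0; rewrite /maxover.
have h0 : head 0 s \in s by case: s s0 => // x s _; exact: mem_head.
(* The fold starts at the head of [s]; the induction runs over lists [t] inside [s] with that start
   kept fixed. *)
suff : forall t, {subset t <= s} ->
    exists2 x, x \in s & foldr (fun x m => Num.max (f x) m) (f (head 0 s)) t = f x.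
  by apply.
elim=> [|x t IH] ts /=; first by exists (head 0 s).
have [z zs ->] := IH (fun y yt => ts y (mem_behead (s := x :: t) yt)).
rewrite maxEle; case: ifP => _; first by exists z.
by exists x => //; apply: ts; exact: mem_head.
Qed.

Lemma dotc_norm_le1 (R : realType) k (x y : 'cV[R]_k) :
  dotc x x <= 1 -> dotc y y <= 1 -> `|dotc x y| <= 1.
Proof.
move=> x1 y1; rewrite -(expr_le1 (n := 2)) // real_normK ?num_real //.
apply: le_trans (CauchySchwarz_dotc _ _) _.
by rewrite mulr_ile1 // dotc_ge0.
Qed.

Section Regret.
Variables (R : realType) (n d b U H : nat) (Q : 'M[R]_(d, b)) (m : 'I_U -> 'cV[R]_b).
Variables (B : 'M[R]_(b, n)) (th : 'I_U -> 'cV[R]_n) (wv : 'I_U -> 'cV[R]_d).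
Variables (us : nat -> 'I_U) (Ds : nat -> seq 'cV[R]_b).
Hypothesis QQ : Q *m Q^T = 1%:M.
Hypothesis thE : forall u, B *m th u = m u + Q^T *m wv u.
Hypothesis wv1 : forall u, dotc (wv u) (wv u) <= 1.
Hypothesis th1 : forall u, dotc (B *m th u) (B *m th u) <= 1.
Hypothesis Ds0 : forall h, (h < H)%N -> Ds h != [::].
Hypothesis Ds1 : forall h x, (h < H)%N -> x \in Ds h -> dotc x x <= 1.
Context (dd : measure_display) (Omega : measurableType dd) (P : probability Omega R).
Variable eta : nat -> Omega -> R.
Hypothesis noise : iid_subgaussian_noise P H eta.

Local Notation pol := (optimistic_policy Q m).
Local Notation action := (action B th pol us Ds eta).

(** Regret of a round without the reward noise, which has mean zero. *)
Definition gap h w := maxover (Ds h) (fun x => dotc x (B *m th (us h)))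
  - dotc (action h w) (B *m th (us h)).

Lemma action_norm h w : (h < H)%N -> dotc (action h w) (action h w) <= 1.
Proof. by move=> hH; apply: (Ds1 hH); apply: action_in; exact: Ds0. Qed.

Lemma gap_le2 h w : (h < H)%N -> `|gap h w| <= 2.
Proof.
move=> hH; rewrite /gap.
have [x xD ->] := maxover_attained (fun x => dotc x (B *m th (us h))) (Ds0 hH).
have := dotc_norm_le1 (Ds1 hH xD) (th1 (us h)).
have := dotc_norm_le1 (action_norm w hH) (th1 (us h)).
rewrite !ler_norml => /andP[? ?] /andP[? ?]; lra.
Qed.

(** Every candidate is then the true parameter, and comparing actions at the same grid index cancels
    the penalty. *)
Lemma gap_le0 h w : d = 0%N -> (h < H)%N -> gap h w <= 0.
Proof.
move=> d0 hH; rewrite /gap.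
have [x xD ->] := maxover_attained (fun x => dotc x (B *m th (us h))) (Ds0 hH).
have [k opt] := action_optimal Q m B th us eta w (Ds0 hH).
have candE : candidate Q (m (us h)) k = B *m th (us h).
  rewrite thE /candidate; congr (_ + _ *m _); apply/colP => i.
  by have := ltn_ord i; rewrite {2}d0.
have := opt x k xD; rewrite /score candE; lra.
Qed.

(** The random term left by [round_regret]: [4 gam] times a grid average of exponential
    supermartingales. *)
Definition mixture h w := 4 / Num.sqrt (visits (sameUser us h) h).+1%:R *
  (#|{: gridIdx d (visits (sameUser us h) h)}|%:R^-1 *
    \sum_(k : gridIdx d (visits (sameUser us h) h))
      expR (logweight Q (wv (us h)) (action ^~ w) (eta ^~ w) k)).

(** Unlike [sameUser us h] it does not change with the round, as the potential argument requires.
    The cut at [H] keeps it to rounds with norm bounds. *)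
Definition user u : pred nat := fun i => (i < H)%N && (us i == u).

Lemma sameUser_user h i : (h < H)%N -> (i < h)%N -> sameUser us h i = user (us h) i.
Proof. by move=> hH ih; rewrite /sameUser /user ih (ltn_trans ih). Qed.

Lemma visits_user h : (h < H)%N -> visits (sameUser us h) h = visits (user (us h)) h.
Proof. by move=> hH; apply: eq_bigr => i _; rewrite sameUser_user. Qed.

Definition contextVec w i : 'cV[R]_d := Q *m action i w.

Lemma gram_user h w : (h < H)%N ->
  gram (fun i => Q *m action i w) (sameUser us h) h = gram (contextVec w) (user (us h)) h.
Proof. by move=> hH; congr (_ + _); apply: eq_bigl => i; rewrite sameUser_user. Qed.

Lemma gap_le_mixture h w : (h < H)%N ->
  gap h w <= (Num.sqrt (visits (user (us h)) h).+1%:R)^-1 *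
      (2 + d%:R + 4 * (d%:R * ln (2 * (d * (visits (user (us h)) h).+1)).+1%:R)) +
    (Num.sqrt (visits (user (us h)) h).+1%:R)^-1^-1 *
      leverage (gram (contextVec w) (user (us h)) h) (contextVec w h) + mixture h w.
Proof.
move=> hH; rewrite /gap.
have [x xD ->] := maxover_attained (fun x => dotc x (B *m th (us h))) (Ds0 hH).
have [k opt] := action_optimal Q m B th us eta w (Ds0 hH).
rewrite -visits_user // -gram_user // thE.
apply: (@round_regret _ _ _ _ QQ h (sameUser us h) (m (us h)) (wv (us h))
  (action ^~ w) (eta ^~ w) (wv1 _) _ _ x k) => //.
- by move=> i ih _; exact: action_norm (ltn_trans ih hH).
- exact: action_norm.
- exact: Ds1 xD.
move=> k'; have := opt x k' xD.
by rewrite !score_hist /sqloss thE.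
Qed.

Lemma sum_visits_user : (\sum_u visits (user u) H = H)%N.
Proof.
rewrite /visits exchange_big /= -[RHS]card_ord -sum1_card; apply: eq_bigr => i _.
rewrite (bigD1 (us i)) //= /user ltn_ord eqxx /= big1 // => u /negPf.
by rewrite eq_sym => ->.
Qed.

Lemma contextVec_norm w u i : user u i -> dotc (contextVec w i) (contextVec w i) <= 1.
Proof.
move=> /andP[iH _]; apply: le_trans (orthonormal_contract QQ _) _.
exact: action_norm.
Qed.

Lemma sum_by_user (F : 'I_U -> nat -> R) :
  \sum_(h < H) F (us h) h =
  \sum_(u | (0 < visits (user u) H)%N) \sum_(h < H | user u h) F u h.
Proof.
rewrite (partition_big (fun h : 'I_H => us h) xpredT) //= [RHS]big_mkcond /=.
apply: eq_bigr => u _.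
have -> : \sum_(h < H | us h == u) F (us h) h = \sum_(h < H | user u h) F u h.
  by apply: eq_big => [h|h /eqP ->] //; rewrite /user ltn_ord.
case: ifP => // T0; apply: big1 => h uh.
by have := visits_lt (ltn_ord h) uh; lia.
Qed.

(** The 2 of each round is raised to 6 and [4 gam] subtracted again, so that the last two sums
    together have nonpositive expectation. *)
Lemma sum_gap_le w : (0 < U)%N -> (0 < H)%N -> (0 < d)%N -> (d ^ 2 * U <= H)%N ->
  1 / 2 <= ln (H%:R / U%:R) :> R ->
  \sum_(h < H) gap h w <=
  123 * d%:R * Num.sqrt (U%:R * H%:R) * ln (H%:R / U%:R)
  - \sum_(h < H) 4 / Num.sqrt (visits (sameUser us h) h).+1%:R
  + \sum_(h < H) mixture h w.
Proof.
move=> U0 H0 d0 dUH l2.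
have := @sum_user_regret_le R U H d (fun u => visits (user u) H) _ U0 H0 d0 dUH erefl l2 sum_visits_user.
set RHS0 := 123 * _ * _ * _ => le123.
have : \sum_(h < H) ((Num.sqrt (visits (user (us h)) h).+1%:R)^-1 *
      (6 + d%:R + 4 * (d%:R * ln (2 * (d * (visits (user (us h)) h).+1)).+1%:R)) +
    (Num.sqrt (visits (user (us h)) h).+1%:R)^-1^-1 *
      leverage (gram (contextVec w) (user (us h)) h) (contextVec w h)) <= RHS0.
  rewrite (sum_by_user (fun u h => (Num.sqrt (visits (user u) h).+1%:R)^-1 *
      (6 + d%:R + 4 * (d%:R * ln (2 * (d * (visits (user u) h).+1)).+1%:R)) +
    (Num.sqrt (visits (user u) h).+1%:R)^-1^-1 *
      leverage (gram (contextVec w) (user u) h) (contextVec w h))).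
  apply: le_trans le123; apply: ler_sum => u Tu.
  by apply: user_regret_bound => // i; exact: contextVec_norm.
move=> leR; apply: (@le_trans _ _ (\sum_(h < H) ((Num.sqrt (visits (user (us h)) h).+1%:R)^-1 *
      (6 + d%:R + 4 * (d%:R * ln (2 * (d * (visits (user (us h)) h).+1)).+1%:R)) +
    (Num.sqrt (visits (user (us h)) h).+1%:R)^-1^-1 *
      leverage (gram (contextVec w) (user (us h)) h) (contextVec w h)
    - 4 / Num.sqrt (visits (sameUser us h) h).+1%:R + mixture h w))).
  apply: ler_sum => h _; apply: le_trans (gap_le_mixture w (ltn_ord h)) _.
  by rewrite visits_user // lerD2r; lra.
by rewrite big_split /= sumrB !lerD2r.
Qed.

Let meta i : (i < H)%N -> measurable_fun setT (eta i).
Proof. by case: noise => + _ _ _ _; exact. Qed.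

(** By [|x| <= expR x + expR (- x)] and the exponential moments at 1 and -1. *)
Lemma integrable_noise i : (i < H)%N -> P.-integrable setT (EFin \o eta i).
Proof.
move=> iH; have mi := meta iH.
have me (s : R) : measurable_fun setT (fun w => (expR (s * eta i w))%:E).
  by apply/measurable_EFinP; apply: measurableT_comp => //; exact: measurable_funM.
apply/integrableP; split; first exact/measurable_EFinP.
apply: (@le_lt_trans _ _ (\int[P]_w ((expR (1 * eta i w))%:E + (expR (-1 * eta i w))%:E))%E).
  apply: ge0_le_integral => //.
  - by apply: measurableT_comp => //; exact/measurable_EFinP.
  - exact: emeasurable_funD.
  move=> w _; rewrite /= -EFinD lee_fin mul1r mulN1r.
  have := expR_ge1Dx (eta i w); have := expR_ge1Dx (- eta i w).
  have := expR_gt0 (eta i w); have := expR_gt0 (- eta i w).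
  by rewrite ler_norml => *; apply/andP; split; lra.
rewrite ge0_integralD //; try by move=> w _; rewrite lee_fin expR_ge0.
case: noise => _ _ _ _ mgf.
apply: (@le_lt_trans _ _ ((expR (1 ^+ 2 / 2))%:E + (expR ((-1) ^+ 2 / 2))%:E)%E).
  by apply: leeD; exact: mgf.
by rewrite -EFinD ltry.
Qed.

(** On rounds of other users the tilt is zero and the supermartingale gains a factor 1. *)
Let tilt h (z : 'cV[R]_d) i w : R :=
  if sameUser us h i then dotc (Q *m action i w) z / 2 else 0.

Lemma logweightE h w (k : gridIdx d (visits (sameUser us h) h)) :
  logweight Q (wv (us h)) (action ^~ w) (eta ^~ w) k =
  let z := gridPt R k - gridPt R (gridNear (visits (sameUser us h) h) (wv (us h))) in
  \sum_(i < h) (tilt h z i w * eta i w - tilt h z i w ^+ 2 / 2).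
Proof.
rewrite /logweight big_mkcond /=; apply: eq_bigr => i _; rewrite /tilt.
by case: ifP => // _; rewrite mul0r expr0n mul0r subr0.
Qed.

Lemma measurable_tilt_self h z i : (i <= H)%N -> measurable_fun setT (tilt h z i).
Proof.
move=> iH; rewrite /tilt; case: (sameUser us h i) => //.
apply: (fin_meas_measurable (fun x => dotc (Q *m x) z / 2)).
by apply: fin_meas_action => j ji; apply: meta; exact: leq_trans iH.
Qed.

Lemma measurable_weight h (k : gridIdx d (visits (sameUser us h) h)) : (h < H)%N ->
  measurable_fun setT (fun w => expR (logweight Q (wv (us h)) (action ^~ w) (eta ^~ w) k)).
Proof.
move=> hH; apply: measurableT_comp => //.
under eq_fun do rewrite logweightE /=.
apply: measurable_sum => i; have iH := ltn_trans (ltn_ord i) hH.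
apply: measurable_funB; first
  by apply: measurable_funM; [exact: measurable_tilt_self (ltnW _)|exact: meta].
by apply: measurable_funM => //; apply: measurable_funX; exact: measurable_tilt_self (ltnW _).
Qed.

(** For a fixed grid point the tilt of round [i] depends only on the noise before [i]. The grid
    point chosen by the policy would not do, since it depends on later noise; hence the average over
    the whole grid. *)
Lemma expectation_weight h (k : gridIdx d (visits (sameUser us h) h)) : (h < H)%N ->
  (\int[P]_w (expR (logweight Q (wv (us h)) (action ^~ w) (eta ^~ w) k))%:E <= 1)%E.
Proof.
move=> hH; under eq_integral do rewrite logweightE /=.
apply: (expectation_exp_supermartingale noise (ltnW hH)) => i ih.
rewrite /tilt; case: (sameUser us h i) => //.
apply: (@fin_meas_measurable _ (pastType eta i) _ _ _ (fun x => dotc (Q *m x) _ / 2)).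
apply: (@fin_meas_action _ _ _ _ _ _ _ _ _ _ _ _ (pastType eta i)) => j ji.
exact: measurable_past.
Qed.

Lemma mixture_ge0 h w : 0 <= mixture h w.
Proof.
rewrite /mixture !mulr_ge0 ?invr_ge0 ?sqrtr_ge0 ?ler0n //.
by apply: sumr_ge0 => k _; exact: expR_ge0.
Qed.

Lemma measurable_mixture h : (h < H)%N -> measurable_fun setT (mixture h).
Proof.
move=> hH; apply: measurable_funM => //; apply: measurable_funM => //.
by apply: measurable_sum => k; exact: measurable_weight.
Qed.

Lemma expectation_mixture h : (h < H)%N ->
  (\int[P]_w (mixture h w)%:E <= (4 / Num.sqrt (visits (sameUser us h) h).+1%:R)%:E)%E.
Proof.
move=> hH; rewrite /mixture; set c := 4 / _; set K := gridIdx d _.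
have c0 : 0 <= c by rewrite divr_ge0 // sqrtr_ge0.
have N0 : (0 < #|{: K}|)%N by rewrite card_gridIdx expn_gt0.
set N : R := #|{: K}|%:R.
under eq_integral => w _.
  rewrite mulrA mulr_sumr -sumEFin.
  under eq_bigr do rewrite EFinM.
  over.
rewrite ge0_integral_sum //; first last.
- by move=> k w _; rewrite -EFinM lee_fin mulr_ge0 ?expR_ge0 // mulr_ge0 ?invr_ge0 ?ler0n.
- move=> k; apply: emeasurable_funM => //; apply/measurable_EFinP; exact: measurable_weight.
apply: (@le_trans _ _ (\sum_(k : K) (c / N)%:E)%E).
  apply: lee_sum => k _; rewrite ge0_integralZl_EFin //; first last.
  - by rewrite mulr_ge0 ?invr_ge0 ?ler0n.
  - by apply/measurable_EFinP; exact: measurable_weight.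
  rewrite -[leRHS]mule1 lee_wpmul2l ?expectation_weight // lee_fin.
  by rewrite mulr_ge0 ?invr_ge0 ?ler0n.
rewrite sumEFin lee_fin sumr_const -mulr_natr -/N divfK //.
by rewrite pnatr_eq0 -lt0n.
Qed.

Lemma measurable_gap h : (h < H)%N -> measurable_fun setT (gap h).
Proof.
move=> hH.
apply: (fin_meas_measurable (fun x => maxover (Ds h) (fun x => dotc x (B *m th (us h)))
  - dotc x (B *m th (us h)))).
by apply: fin_meas_action => j ji; apply: meta; exact: ltn_trans hH.
Qed.

Lemma integrable_gap h : (h < H)%N -> P.-integrable setT (EFin \o gap h).
Proof.
move=> hH; apply: (@le_integrable _ _ _ _ _ measurableT _ (EFin \o cst 2)).
- by apply/measurable_EFinP; exact: measurable_gap.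
- move=> w _; rewrite /= lee_fin [leRHS]ger0_norm //.
  exact: gap_le2.
- exact: finite_measure_integrable_cst.
Qed.

Lemma realized_regretE w : realized_regret B th pol us Ds eta H w =
  \sum_(h < H) gap h w - \sum_(h < H) eta h w.
Proof.
rewrite -sumrB; apply: eq_bigr => h _.
by rewrite /gap -addrA -opprD.
Qed.

Lemma integrable_sum_gap : P.-integrable setT (EFin \o (fun w => \sum_(h < H) gap h w)).
Proof.
rewrite (_ : _ \o _ = (fun w => \sum_(h < H) (EFin \o gap h) w)%E).
  by apply: integrable_sum => // h _; exact: integrable_gap.
by apply/funext => w /=; rewrite sumEFin.
Qed.

Lemma integrable_sum_noise : P.-integrable setT (EFin \o (fun w => \sum_(h < H) eta h w)).
Proof.
rewrite (_ : _ \o _ = (fun w => \sum_(h < H) (EFin \o eta h) w)%E).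
  by apply: integrable_sum => // h _; exact: integrable_noise.
by apply/funext => w /=; rewrite sumEFin.
Qed.

Lemma integrable_regret :
  P.-integrable setT (EFin \o realized_regret B th pol us Ds eta H).
Proof.
rewrite (_ : _ \o _ = (EFin \o (fun w => (\sum_(h < H) gap h w)%R)) \-
    (EFin \o (fun w => (\sum_(h < H) eta h w)%R)))%E.
  exact: integrableB integrable_sum_gap integrable_sum_noise.
by apply/funext => w /=; rewrite realized_regretE.
Qed.

(** The noise averages out, so a pathwise bound on the gaps suffices. [G] is zero in the two
    degenerate regimes and the sum of the mixtures in the main one. *)
Lemma expectation_regret_le (a c : R) (G : Omega -> R) :
  measurable_fun setT G -> (forall w, 0 <= G w) -> (\int[P]_w (G w)%:E <= c%:E)%E ->
  (forall w, \sum_(h < H) gap h w <= a + G w) ->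
  ('E_P[realized_regret B th pol us Ds eta H] <= (a + c)%:E)%E.
Proof.
move=> mG G0 Gc le.
rewrite unlock; under eq_integral do rewrite realized_regretE EFinB.
rewrite integralB_EFin //; [|exact: integrable_sum_gap|exact: integrable_sum_noise].
have -> : (\int[P]_w (\sum_(h < H) eta h w)%:E = 0)%E.
  under eq_integral do rewrite -sumEFin.
  rewrite integral_sum //; last by move=> h; exact: integrable_noise.
  case: noise => _ _ _ mean _.
  by apply: big1 => h _; have := mean h (ltn_ord h); rewrite unlock.
rewrite sube0.
have iG : P.-integrable setT (EFin \o G).
  apply/integrableP; split; first exact/measurable_EFinP.
  under eq_integral do rewrite /= ger0_norm //.
  exact: le_lt_trans Gc (ltry _).
have ia : P.-integrable setT (EFin \o cst a) by exact: finite_measure_integrable_cst.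
apply: (@le_trans _ _ (\int[P]_w ((EFin \o cst a) w + (EFin \o G) w))%E).
  apply: le_integral => //; [exact: integrable_sum_gap|exact: integrableD|].
  by move=> w _; rewrite /= -EFinD lee_fin.
rewrite integralD //= integral_cst // [X in (a%:E * X)%E](_ : _ = 1%E);
  last exact: probability_setT.
rewrite mule1 EFinD; exact: leeD.
Qed.
End Regret.

(** * Codimension, trivial regime and the final bound *)

Lemma kappa_codim (R : realType) a b n (A : 'M[R]_(a, n)) (B : 'M[R]_(b, n)) :
  (1 - kappa A B) * b%:R = (b - \rank (A :&: B)%MS)%:R.
Proof.
have rb : (\rank (A :&: B)%MS <= b)%N.
  by apply: leq_trans (mxrankS (capmxSr A B)) _; exact: rank_leq_row.
rewrite natrB // /kappa mulrBl mul1r; congr (_ - _).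
(* For [b = 0] the quotient by zero is zero, and the rank vanishes as well. *)
have [b0|b0] := posnP b; last by rewrite divfK // pnatr_eq0 -lt0n.
by move: rb; rewrite {2}b0 leqn0 => /eqP ->; rewrite mul0r mul0r.
Qed.

(** Here [H <= d sqrt (U H)], while the logarithm is at least 1/2. *)
Lemma trivial_regime_bound (R : realType) (U H d : nat) :
  (H < d ^ 2 * U)%N -> 1 / 2 <= ln (H%:R / U%:R) :> R ->
  2 * H%:R <= 123 * d%:R * Num.sqrt (U%:R * H%:R) * ln (H%:R / U%:R) :> R.
Proof.
move=> dUH l2.
have HdUH : H%:R <= d%:R * Num.sqrt (U%:R * H%:R) :> R.
  rewrite -[leLHS]ger0_norm ?ler0n // -[d%:R]ger0_norm ?ler0n // -!sqrtr_sqr.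
  rewrite -sqrtrM ?sqr_ge0 // ler_sqrt ?mulr_ge0 ?sqr_ge0 ?ler0n //.
  rewrite -!natrX -!natrM ler_nat mulnA -mulnn leq_mul2r.
  by rewrite (ltnW dUH) orbT.
have : 0 <= d%:R * Num.sqrt (U%:R * H%:R) * (ln (H%:R / U%:R) - 1 / 2) :> R.
  by rewrite !mulr_ge0 ?ler0n ?sqrtr_ge0 // subr_ge0.
have : 0 <= d%:R * Num.sqrt (U%:R * H%:R) :> R by rewrite mulr_ge0 ?sqrtr_ge0.
lra.
Qed.

(** The constant is absolute, and the policy is fixed before [th], the users and the decision sets.
    The condition [2 * U <= H] keeps the logarithm away from zero. The first two conclusions make
    the actions admissible and the expectation a genuine integral. *)
Theorem theorem2 (R : realType) :
  exists C : R, 0 < C /\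
  forall (n a b U H : nat), (1 <= U)%N -> (2 * U <= H)%N ->
  forall (A : 'M[R]_(a, n)) (B : 'M[R]_(b, n)), row_free A -> row_free B ->
  forall (y : 'I_U -> 'cV[R]_a),
  exists pol : policy R b U, causal pol /\
  forall th : 'I_U -> 'cV[R]_n,
    (forall u, A *m th u = y u) ->
    (forall u, norm2 (th u) <= 1) ->
    (forall u, norm2 (B *m th u) <= 1) ->
  forall (us : nat -> 'I_U) (Ds : nat -> seq 'cV[R]_b),
    (forall h, (h < H)%N -> Ds h != [::]) ->
    (forall h x, (h < H)%N -> x \in Ds h -> norm2 x <= 1) ->
  forall (d : measure_display) (Omega : measurableType d)
         (P : probability Omega R) (eta : nat -> Omega -> R),
    iid_subgaussian_noise P H eta ->
    [/\ forall h w, (h < H)%N -> action B th pol us Ds eta h w \in Ds h,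
        P.-integrable setT (EFin \o realized_regret B th pol us Ds eta H) &
        ('E_P[realized_regret B th pol us Ds eta H] <=
          (C * (1 - kappa A B) * b%:R * Num.sqrt (U%:R * H%:R)
             * ln (H%:R / U%:R))%:E)%E].
Proof.
exists 123; split=> // n a b U H U1 UH A B rA rB y.
have [d dE [Q QQ QB]] : exists2 d, d = (b - \rank (A :&: B)%MS)%N &
    exists2 Q : 'M[R]_(d, b), Q *m Q^T = 1%:M &
      forall z : 'cV[R]_n, A *m z = 0 -> Q^T *m Q *m (B *m z) = B *m z.
  by exists (b - \rank (A :&: B)%MS)%N => //; exact: unknown_part_basis.
(* [z u] solves [A z = y u], so [m u] is known to the agent; removing the projection leaves the
   unidentified part to [Q^T *m wv u]. *)
pose z u := pinvmx A *m y u.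
pose m u := B *m z u - Q^T *m Q *m (B *m z u).
exists (optimistic_policy Q m); split; first exact: optimistic_policy_causal.
move=> th Ath _ th1' us Ds Ds0 Ds1' dd Omega P eta noise.
pose wv u := Q *m (B *m th u).
have th1 u : dotc (B *m th u) (B *m th u) <= 1 by rewrite -norm2_le1.
have Ds1 h x : (h < H)%N -> x \in Ds h -> dotc x x <= 1.
  by move=> hH xD; rewrite -norm2_le1; exact: Ds1' xD.
have wv1 u : dotc (wv u) (wv u) <= 1.
  exact: le_trans (orthonormal_contract QQ _) (th1 u).
have thE u : B *m th u = m u + Q^T *m wv u.
  have Az : A *m (th u - z u) = 0.
    by rewrite mulmxBr Ath mulmxA mulmxVp // mul1mx subrr.
  have := QB _ Az; rewrite !mulmxBr /m /wv (mulmxA Q^T) => E.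
  rewrite -addrA [- _ + _]addrC E.
  by rewrite addrC subrK.
have l2 : 1 / 2 <= ln (H%:R / U%:R) :> R.
  apply: le_trans (ln2_ge_half R) _.
  have U0 : 0 < U%:R :> R by rewrite ltr0n.
  have H0 : 0 < H%:R :> R by rewrite ltr0n (leq_trans _ UH) // muln_gt0.
  rewrite ler_ln ?posrE ?divr_gt0 // ler_pdivlMr //.
  by rewrite -natrM ler_nat.
split.
- by move=> h w hH; apply: action_in; exact: Ds0.
- exact: (integrable_regret Q m us th1 Ds0 Ds1 noise).
rewrite -(mulrA 123) kappa_codim -dE.
have expect := @expectation_regret_le R n d b U H Q m B th us Ds th1 Ds0 Ds1 dd Omega P eta noise.
have G0 : (\int[P]_w (0 : R)%:E <= 0%:E)%E by rewrite integral0.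
have [d0|d0] := posnP d.
  apply: le_trans (expect 0 0 (fun=> 0) _ _ G0 _) _ => //.
    move=> w; rewrite addr0; apply: sumr_le0 => h _.
    exact: (gap_le0 us thE Ds0 eta w d0 (ltn_ord h)).
  by rewrite addr0 lee_fin d0 mulr0 !mul0r.
(* When [d^2 U > H], a regret of 2 per round is already below the bound. *)
have [dUH|dUH] := leqP (d ^ 2 * U) H; last first.
  apply: le_trans (expect (2 * H%:R) 0 (fun=> 0) _ _ G0 _) _ => //.
    move=> w; rewrite addr0; apply: (@le_trans _ _ (\sum_(h < H) 2)).
      apply: ler_sum => h _; apply: le_trans (ler_norm _) _.
      exact: (gap_le2 Q m us th1 Ds0 Ds1 eta w (ltn_ord h)).
    by rewrite sumr_const card_ord mulr_natr.
  by rewrite addr0 lee_fin; exact: trivial_regime_bound.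
pose c := \sum_(h < H) 4 / Num.sqrt (visits (sameUser us h) h).+1%:R : R.
pose G w := \sum_(h < H) mixture Q m B th wv us Ds eta h w.
have H0 : (0 < H)%N by rewrite (leq_trans _ UH) // muln_gt0.
(* The deterministic part contains [- c] and the expectation of [G] is at most [c], so [c]
   cancels. *)
apply: le_trans (expect _ c G _ _ _ (fun w =>
   sum_gap_le us QQ thE wv1 Ds0 Ds1 eta w U1 H0 d0 dUH l2)) _.
- by apply: measurable_sum => h; exact: (measurable_mixture Q m B th wv us Ds noise (ltn_ord h)).
- by move=> w; apply: sumr_ge0 => h _; exact: mixture_ge0.
- under eq_integral do rewrite -sumEFin.
  rewrite ge0_integral_sum //; first last.
  + by move=> h w _; rewrite lee_fin mixture_ge0.
  + by move=> h; apply/measurable_EFinP; exact: (measurable_mixture Q m B th wv us Ds noise (ltn_ord h)).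
  rewrite /c -sumEFin; apply: lee_sum => h _.
  exact: (expectation_mixture Q m B th wv us Ds noise (ltn_ord h)).
by rewrite subrK.
Qed.
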